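(* Let $(M,\phi)\in\mathrm{MIC}(\widehat{\mathbf O})$ have rank $r$ and exponents $\lambda_1,\dots,\lambda_r$. (1) There exists a (possibly non-unique) $\phi$-stable $\mathbf O^\dagger$-lattice $M^\dagger\subset M$. (2) If $\mathrm{type}(-\lambda_i)>0$ for all $i$, then for any $\phi$-stable $\mathbf O^\dagger$-lattice $M^\dagger$ of $M$, the natural map $\mathrm{R}\Gamma(\phi,M^\dagger)\to\mathrm{R}\Gamma(\phi,M)$ is a quasi-isomorphism. (3) If $\mathrm{type}(\lambda_i-\lambda_j)>0$ for all pairs $i,j$ (including $i=j$), then the $\phi$-stable $\mathbf O^\dagger$-lattice of $M$ is unique (as a subset of $M$).
   Context: Let $E$ be a field of characteristic $0$ with a valuation $v$ with $v(p)>0$ (not necessarily complete), and $\overline E$ an algebraic closure with an extension of $v$. Let $\widehat{\mathbf O}=E[[z]]$ and $\mathbf O^\dagger\subset\widehat{\mathbf O}$ the subring $\bigcup_{r}E\langle z/p^r\rangle$ of power series with positive radius of convergence. For $A\in\{\mathbf O^\dagger,\widehat{\mathbf O}\}$, $\mathrm{MIC}(A)$ is the category of regular connections: finite free $A$-modules $M$ with an $E$-linear $\phi:M\to M$ satisfying $\phi(fx)=z\frac{df}{dz}x+f\phi(x)$. The exponents are the eigenvalues in $\overline E$ of the induced map on $M/zM$. $\mathrm{R}\Gamma(\phi,M)$ is the complex $[M\xrightarrow{\phi}M]$. A $\phi$-stable $\mathbf O^\dagger$-lattice of $M\in\mathrm{MIC}(\widehat{\mathbf O})$ is a $\phi$-stable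 finite free $\mathbf O^\dagger$-submodule $M^\dagger\subset M$ with $M^\dagger\otimes_{\mathbf O^\dagger}\widehat{\mathbf O}\to M$ an isomorphism. For $\lambda\in\overline E$, $\mathrm{type}(\lambda)\in[0,1]$ is the radius of convergence of $\sum_{m\ge0,m\ne\lambda}z^m/(\lambda-m)$ (with respect to the absolute value normalized so that $|p|=p^{-1}$). *)

(* Defs.v *)
From HB Require Import structures.
From mathcomp Require Import all_boot all_order all_algebra.
From mathcomp Require Import generic_quotient ring_quotient.
From mathcomp Require Import boolp classical_sets functions reals ereal topology.
From mathcomp Require Import normedtype sequences exp.

Set Implicit Arguments.
Unset Strict Implicit.
Unset Printing Implicit Defensive.

Import Order.TTheory GRing.Theory Num.Theory.
Import numFieldNormedType.Exports.

Local Open Scope classical_set_scope.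
Local Open Scope ring_scope.
Local Open Scope quotient_scope.

Record fps (E : fieldType) := Fps { fcoef : nat -> E }.

HB.instance Definition _ (E : fieldType) := [isNew for @fcoef E].
HB.instance Definition _ (E : fieldType) := [Choice of fps E by <:].

Section PowerSeriesRing.
Variable E : fieldType.
Implicit Types f g h : fps E.

Lemma fpsP f g : (forall n, fcoef f n = fcoef g n) -> f = g.
Proof. by move=> fg; apply: val_inj; apply: funext. Qed.

Definition fpsC (c : E) : fps E := Fps (fun n => if n == 0%N then c else 0).
Definition fpsz : fps E := Fps (fun n => (n == 1%N)%:R).
Definition fps_opp f : fps E := Fps (fun n => - fcoef f n).
Definition fps_add f g : fps E := Fps (fun n => fcoef f n + fcoef g n).
Definition fps_mul f g : fps E :=
  Fps (fun n => \sum_(i < n.+1) fcoef f i * fcoef g (n - i)%N).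
Definition fps_deriv f : fps E := Fps (fun n => fcoef f n.+1 *+ n.+1).

Lemma fps_addA : associative fps_add.
Proof. by move=> f g h; apply: fpsP => n /=; rewrite addrA. Qed.
Lemma fps_addC : commutative fps_add.
Proof. by move=> f g; apply: fpsP => n /=; rewrite addrC. Qed.
Lemma fps_add0 : left_id (fpsC 0) fps_add.
Proof. by move=> f; apply: fpsP => n /=; rewrite if_same add0r. Qed.
Lemma fps_addN : left_inverse (fpsC 0) fps_opp fps_add.
Proof. by move=> f; apply: fpsP => n /=; rewrite if_same addNr. Qed.

HB.instance Definition _ :=
  GRing.isZmodule.Build (fps E) fps_addA fps_addC fps_add0 fps_addN.

Definition fps_trunc m f : {poly E} := \poly_(i < m) fcoef f i.

Lemma coef_trunc m f i : (i < m)%N -> (fps_trunc m f)`_i = fcoef f i.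
Proof. by move=> im; rewrite coef_poly im. Qed.

Lemma fcoef_mul m f g n : (n < m)%N ->
  fcoef (fps_mul f g) n = (fps_trunc m f * fps_trunc m g)`_n.
Proof.
move=> nm; rewrite coefM /=; apply: eq_bigr => i _.
rewrite !coef_trunc //; first by rewrite (leq_ltn_trans (leq_subr _ _)).
by apply: leq_trans nm; apply: ltn_ord.
Qed.

Lemma fps_mulC : commutative fps_mul.
Proof.
by move=> f g; apply: fpsP => n; rewrite !(@fcoef_mul n.+1) // mulrC.
Qed.

Lemma fps_mulA : associative fps_mul.
Proof.
move=> f g h; apply: fpsP => n.
transitivity ((fps_trunc n.+1 f * (fps_trunc n.+1 g * fps_trunc n.+1 h))`_n).
  rewrite coefM /=; apply: eq_bigr => i _.
  have lin := ltn_ord i.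
  rewrite coef_trunc //; congr (_ * _).
  by apply: fcoef_mul; rewrite ltnS leq_subr.
rewrite mulrA coefM /=; apply: eq_bigr => i _.
rewrite (@coef_trunc _ h) ?ltnS ?leq_subr //; congr (_ * _).
by rewrite -fcoef_mul.
Qed.

Lemma fps_mul1 : left_id (fpsC 1) fps_mul.
Proof.
move=> f; apply: fpsP => n /=; rewrite big_ord_recl /= mul1r subn0.
by rewrite big1 ?addr0 // => i _; rewrite mul0r.
Qed.

Lemma fps_mulDl : left_distributive fps_mul +%R.
Proof.
move=> f g h; apply: fpsP => n /=; rewrite -big_split /=.
by apply: eq_bigr => i _; rewrite mulrDl.
Qed.

Lemma fps_1_neq0 : fpsC 1 != 0.
Proof.
by apply/eqP => /(congr1 (fun f => fcoef f 0)) /= /eqP; rewrite oner_eq0.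
Qed.

HB.instance Definition _ := GRing.Zmodule_isComNzRing.Build (fps E)
  fps_mulA fps_mulC fps_mul1 fps_mulDl fps_1_neq0.

Lemma fpsCD c d : fpsC (c + d) = fpsC c + fpsC d.
Proof. by apply: fpsP => -[|n] //=; rewrite addr0. Qed.

Lemma fpsCM c d : fpsC (c * d) = fpsC c * fpsC d.
Proof.
apply: fpsP => n; rewrite -[fpsC c * fpsC d]/(fps_mul _ _) /=.
rewrite big_ord_recl /= subn0 big1 ?addr0; last by move=> i _; rewrite mul0r.
by case: n => //=; rewrite mulr0.
Qed.

End PowerSeriesRing.

Arguments fpsC {E} c.
Arguments fpsz {E}.

Section Valuations.
Variable R : realType.

Record is_valuation (K : fieldType) (v : K -> \bar R) : Prop := {
  val_zero : v 0 = +oo%E;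
  val_fin : forall x : K, x != 0 -> v x \is a fin_num;
  val_mul : forall x y, v (x * y) = (v x + v y)%E;
  val_add : forall x y, (mine (v x) (v y) <= v (x + y)%R)%E
}.

(* The absolute value attached to [v], normalized by |p| = p^-1. *)
Definition nabs (K : fieldType) (v : K -> \bar R) (p : nat) (x : K) : R :=
  if x == 0 then 0 else p%:R `^ (- (fine (v x) / fine (v p%:R))).

(* f belongs to E<z/p^s>: a series in z/p^s with coefficients tending to 0. *)
Definition tate (E : fieldType) (v : E -> \bar R) (p s : nat) (f : fps E) :=
  (fun n => nabs v p (fcoef f n * p%:R ^+ (s * n)) : R^o) @ \oo --> (0 : R^o).

Definition Odag (E : fieldType) (v : E -> \bar R) (p : nat) : set (fps E) :=
  [set f | exists s, tate v p s f].

Definition conv_radius (K : fieldType) (v : K -> \bar R) (p : nat)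
    (a : nat -> K) : \bar R :=
  ereal_sup [set rho%:E | rho in
    [set rho : R | 0 <= rho /\
       (fun n => nabs v p (a n) * rho ^+ n : R^o) @ \oo --> (0 : R^o)]].

(* The radius of convergence of \sum_(m >= 0, m != lam) z^m / (lam - m). *)
Definition exptype (K : fieldType) (v : K -> \bar R) (p : nat) (lam : K) :=
  conv_radius v p (fun m => if m%:R == lam then 0 else (lam - m%:R)^-1).

End Valuations.

Definition is_alg_closure (E : fieldType) (Ebar : closedFieldType)
  (iota : {rmorphism E -> Ebar}) := forall x, algebraicOver iota x.

Definition is_basis (A : pzRingType) (M : lmodType A) n (b : 'I_n -> M) :=
  forall x, exists! c : {ffun 'I_n -> A}, x = \sum_i c i *: b i.

Record is_MIC (E : fieldType) (M : lmodType (fps E)) (phi : M -> M) (r : nat) :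
    Prop := {
  mic_free : exists b : 'I_r -> M, is_basis b;
  mic_linear : forall (c : E) x y,
    phi (fpsC c *: x + y) = fpsC c *: phi x + phi y;
  mic_leibniz : forall (f : fps E) x,
    phi (f *: x) = (fpsz * fps_deriv f) *: x + f *: phi x
}.

Section Fiber.
Variables (E : fieldType) (M : lmodType (fps E)).

Definition zM : {pred M} := fun x => `[< exists y, x = fpsz *: y >].

Lemma zMP x : reflect (exists y, x = fpsz *: y) (x \in zM).
Proof. exact: asboolP. Qed.

Lemma zM_closed : zmod_closed zM.
Proof.
split; first by apply/zMP; exists 0; rewrite scaler0.
move=> _ _ /zMP[x ->] /zMP[y ->]; apply/zMP; exists (x - y).
by rewrite scalerBr.
Qed.

HB.instance Definition _ := GRing.isZmodClosed.Build M zM zM_closed.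

Definition fiber := {ideal_quot zM}.

HB.instance Definition _ := GRing.Zmodule.on fiber.

Definition fiber_pi (x : M) : fiber := \pi_({ideal_quot zM}) x.
Definition fiber_repr (y : fiber) : M := repr (y : {ideal_quot zM}).

Lemma fiber_reprK y : fiber_pi (fiber_repr y) = y.
Proof. exact: reprK. Qed.

Lemma fiber_piP x y : (fiber_pi x = fiber_pi y) <-> (x - y \in zM).
Proof.
rewrite /fiber_pi; split=> [/eqP|h]; first by rewrite -Quotient.idealrBE.
by apply/eqP; rewrite -Quotient.idealrBE.
Qed.

Lemma fiber_piD x y : fiber_pi (x + y) = fiber_pi x + fiber_pi y.
Proof. exact: (raddfD \pi_({ideal_quot zM})). Qed.

Definition fiber_scale (c : E) (y : fiber) : fiber :=
  fiber_pi (fpsC c *: fiber_repr y).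

Lemma fiber_scale_pi c x : fiber_scale c (fiber_pi x) = fiber_pi (fpsC c *: x).
Proof.
apply/fiber_piP; rewrite -scalerBr.
have /fiber_piP/zMP[y ->] := fiber_reprK (fiber_pi x).
by apply/zMP; exists (fpsC c *: y); rewrite !scalerA mulrC.
Qed.

Lemma fiber_scaleA a b y :
  fiber_scale a (fiber_scale b y) = fiber_scale (a * b) y.
Proof. by rewrite [fiber_scale b y]/fiber_scale fiber_scale_pi scalerA -fpsCM. Qed.

Lemma fiber_scale1 : left_id 1 fiber_scale.
Proof.
by move=> y; rewrite /fiber_scale -[fpsC 1]/(1 : fps E) scale1r fiber_reprK.
Qed.

Lemma fiber_scaleDr : right_distributive fiber_scale +%R.
Proof.
move=> c x y; rewrite -(fiber_reprK x) -(fiber_reprK y) -fiber_piD.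
by rewrite !fiber_scale_pi -fiber_piD scalerDr.
Qed.

Lemma fiber_scaleDl y : {morph fiber_scale^~ y : a b / a + b}.
Proof. by move=> a b; rewrite /fiber_scale -fiber_piD fpsCD scalerDl. Qed.

HB.instance Definition _ := GRing.Zmodule_isLmodule.Build E fiber
  fiber_scaleA fiber_scale1 fiber_scaleDr fiber_scaleDl.

Definition fiber_map (phi : M -> M) (y : fiber) : fiber :=
  fiber_pi (phi (fiber_repr y)).

Lemma fiber_map_pi phi r x : is_MIC phi r ->
  fiber_map phi (fiber_pi x) = fiber_pi (phi x).
Proof.
move=> [_ lin leib]; apply/fiber_piP.
have phiB u w : phi (u - w) = phi u - phi w.
  have N1 : fpsC (- 1) = - 1 :> fps E.
    by apply: fpsP => -[|n] //=; rewrite oppr0.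
  by have := lin (- 1) w u; rewrite N1 !scaleN1r addrC => ->; rewrite addrC.
have /fiber_piP/zMP[y xy] := fiber_reprK (fiber_pi x).
rewrite -phiB xy leib; apply/zMP.
by exists (fps_deriv fpsz *: y + phi y); rewrite scalerDr scalerA.
Qed.

(* [lam] lists, with multiplicity, the eigenvalues in [Ebar] of the map
   induced by [phi] on the E-vector space M/zM. *)
Definition is_exponents (Ebar : closedFieldType) (iota : {rmorphism E -> Ebar})
    (phi : M -> M) r (lam : 'I_r -> Ebar) :=
  exists (b : 'I_r -> fiber) (B : 'M[E]_r),
    [/\ is_basis b,
        forall j, fiber_map phi (b j) = \sum_i B i j *: b i
      & map_poly iota (char_poly B) = \prod_i ('X - (lam i)%:P)].

End Fiber.

Section Lattices.
Variables (E : fieldType) (M : lmodType (fps E)).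
Variable O : set (fps E).
Implicit Types (N : set M) (f g : fps E) (s t : seq (M * fps E)).

(* For an O-submodule N of M, [formal_tensor N] modulo [tensor_eq N] is
   the tensor product of N and E[[z]] over O: a list of pairs (x, f) stands for
   the sum of the tensors of x and f, and [tensor_eq N] is the least congruence
   making this sum commutative and the tensors O-bilinear. *)
Definition formal_tensor N s := forall u, u \in s -> N u.1.

Inductive tensor_eq N : seq (M * fps E) -> seq (M * fps E) -> Prop :=
| tens_refl s : tensor_eq N s s
| tens_sym s t : tensor_eq N s t -> tensor_eq N t s
| tens_trans s t u : tensor_eq N s t -> tensor_eq N t u -> tensor_eq N s u
| tens_cat s s' t t' : tensor_eq N s s' -> tensor_eq N t t' ->
    tensor_eq N (s ++ t) (s' ++ t')
| tens_comm s t : tensor_eq N (s ++ t) (t ++ s)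
| tens_zero f : tensor_eq N [:: (0, f)] [::]
| tens_addl x y f : N x -> N y ->
    tensor_eq N [:: (x + y, f)] [:: (x, f); (y, f)]
| tens_addr x f g : N x -> tensor_eq N [:: (x, f + g)] [:: (x, f); (x, g)]
| tens_scale a x f : O a -> N x ->
    tensor_eq N [:: (a *: x, f)] [:: (x, a * f)].

Definition tensor_eval s : M := \sum_(u <- s) u.2 *: u.1.

Definition base_change_iso N :=
  (forall s t, formal_tensor N s -> formal_tensor N t ->
     tensor_eval s = tensor_eval t -> tensor_eq N s t) /\
  (forall x : M, exists s, formal_tensor N s /\ tensor_eval s = x).

Record is_lattice (phi : M -> M) N : Prop := {
  lat_zero : N 0;
  lat_add : forall x y, N x -> N y -> N (x + y);
  lat_scale : forall f x, O f -> N x -> N (f *: x);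
  lat_free : exists (n : nat) (b : 'I_n -> M), (forall i, N (b i)) /\
    forall x, N x -> exists! c : {ffun 'I_n -> fps E},
      (forall i, O (c i)) /\ x = \sum_i c i *: b i;
  lat_stable : forall x, N x -> N (phi x);
  lat_base_change : base_change_iso N
}.

End Lattices.

(* The map Z/B -> Z'/B' induced by an inclusion (Z, B) in (Z', B') of pairs
   of subgroups of V is injective and surjective. *)
Definition subquotient_iso (V : zmodType) (Z B Z' B' : set V) :=
  (forall x, Z x -> B' x -> B x) /\
  (forall x', Z' x' -> exists2 x, Z x & B' (x' - x)).

(* [N --phi--> N] -> [N' --phi--> N'] is an isomorphism on H^0 and on H^1,
   where N is contained in N' and both are phi-stable. *)
Definition RGamma_quasi_iso (V : zmodType) (phi : V -> V) (N N' : set V) :=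
  subquotient_iso (N `&` [set x | phi x = 0]) [set 0]
                  (N' `&` [set x | phi x = 0]) [set 0] /\
  subquotient_iso N (phi @` N) N' (phi @` N').

(* Main.v *)
Require Import Defs.
From HB Require Import structures.
From mathcomp Require Import all_boot all_order all_algebra.
From mathcomp Require Import boolp classical_sets functions reals ereal topology.
From mathcomp Require Import normedtype sequences exp.
From mathcomp Require Import ring.

Set Implicit Arguments.
Unset Strict Implicit.
Unset Printing Implicit Defensive.

Import Order.TTheory GRing.Theory Num.Theory.
Import numFieldNormedType.Exports.
Local Open Scope classical_set_scope.
Local Open Scope ring_scope.

(** In a basis of [M] the connection is [z d/dz + A] with [A = A_0 + A_1 z + ...],
    and solving a linear equation for it degree by degree means inverting
    [Q |-> k Q + A_0 Q - Q V_0] for all large [k].  By Cayley-Hamilton such a [Q]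
    satisfies [chi (k + A_0) Q = T'] where [chi] is the characteristic polynomial
    of [V_0] and [T'] is bounded by the right-hand side; since
    [det (chi (k + A_0))] is the product of the [k + lam_i - mu_j], the inverse
    exists for large [k] and its norm is at most a constant times the product of
    the [1 / |k + lam_i - mu_j|].

    Existence of a lattice: the gauge transformation to the truncation of [A] is a
    formal solution of such an equation, and a polynomial matrix is convergent.

    Convergence of formal solutions: positivity of the types bounds each small
    denominator [1 / |k + l|] geometrically.  Their product over [k <= N] is then
    also geometrically bounded, because every denominator but the largest is
    dominated by the inverse of the distance of its index to that of the largest,
    and [1 / |N!| <= p ^ N].  Hence a formal solution with convergent data
    converges.  Applied to [phi y = x] this gives the comparison of cohomology,
    and applied to the change of basis between two lattices it gives uniqueness. *)

(** * p-adic absolute values and small denominators *)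

(** A valuation rewritten multiplicatively, so that estimates over [E] and over its algebraic
    closure become inequalities between real numbers. *)
Record is_pabs (R : realType) (p : nat) (K : fieldType) (a : K -> R) : Prop := {
  pabs_ge0 : forall x, 0 <= a x;
  pabs_eq0 : forall x, (a x == 0) = (x == 0);
  pabsM : forall x y, a (x * y) = a x * a y;
  pabsD : forall x y, a (x + y) <= Num.max (a x) (a y);
  pabs_p : a p%:R = p%:R^-1 }.

Lemma nabs_is_pabs (R : realType) (p : nat) (K : fieldType) (v : K -> \bar R) :
  prime p -> p%:R != 0 :> K -> is_valuation v -> (0 < v p%:R)%E ->
  is_pabs p (nabs v p).
Proof.
move=> pp p0 vv vp.
have vf x : x != 0 -> v x \is a fin_num by exact: (val_fin vv).
have w0 : 0 < fine (v p%:R).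
  by rewrite -lte_fin fineK ?vf.
have p1 : 1 <= p%:R :> R by rewrite ler1n prime_gt0.
have pgt0 : 0 < p%:R :> R by rewrite ltr0n prime_gt0.
split.
- by move=> x; rewrite /nabs; case: eqP => // _; rewrite powR_ge0.
- move=> x; rewrite /nabs; case: (x =P 0) => [_|_]; first by rewrite eqxx.
  by rewrite gt_eqF // powR_gt0.
- move=> x y; rewrite /nabs mulf_eq0.
  case: (x =P 0) => [_|/eqP x0] /=; first by rewrite mul0r.
  case: (y =P 0) => [_|/eqP y0] /=; first by rewrite mulr0.
  rewrite -powRD; last by rewrite (gt_eqF pgt0) implybT.
  by rewrite (val_mul vv) fineD ?vf // mulrDl opprD.
- move=> x y; rewrite /nabs.
  case: (x =P 0) => [->|/eqP x0] /=.
    by rewrite add0r le_max lexx orbT.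
  case: (y =P 0) => [->|/eqP y0] /=.
    by rewrite addr0 (negbTE x0) le_max lexx.
  case: (x + y =P 0) => [_|/eqP xy0].
    by rewrite le_max powR_ge0.
  have := val_add vv x y; rewrite -[v x]fineK ?vf // -[v y]fineK ?vf //.
  rewrite -[v (x + y)]fineK ?vf // -EFin_min lee_fin ge_min le_max.
  have mon s t : s <= t ->
      p%:R `^ (- (t / fine (v p%:R))) <= p%:R `^ (- (s / fine (v p%:R))).
    by move=> st; rewrite ler_powR // lerN2 ler_pM2r // invr_gt0.
  by case/orP => /mon ->; rewrite ?orbT.
- by rewrite /nabs (negbTE p0) divff ?gt_eqF // powR_inv1 // ltW.
Qed.

(** The indices below [m] contribute [m!], those above it contribute [(N - m)!]. *)
Lemma prod_dist m N : (m <= N)%N ->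
  (\prod_(0 <= k < N.+1 | k != m) `|m - k| = m`! * (N - m)`!)%N.
Proof.
elim: N => [|N IH].
  by rewrite leqn0 => /eqP ->; rewrite big_mkcond big_nat1 fact0.
rewrite leq_eqVlt => /predU1P[->|].
  rewrite subnn fact0 muln1 big_mkcond big_nat_recr //= eqxx muln1 -ffactnn.
  rewrite ffact_prod big_mkord; apply: eq_bigr => k _.
  by rewrite neq_ltn ltn_ord distnEl // ltnW.
rewrite ltnS => mN; rewrite big_mkcond big_nat_recr //= -big_mkcond IH //.
rewrite neq_ltn ltnS mN orbT distnEr ?leqW // subSn // factS.
by rewrite -mulnA (mulnC (N - m)`!).
Qed.

Section PadicAbs.
Context (R : realType) (p : nat) (K : fieldType) (a : K -> R).
Hypotheses (pp : prime p) (ha : is_pabs p a).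

Lemma pabs0 : a 0 = 0.
Proof. by apply/eqP; rewrite (pabs_eq0 ha). Qed.

Lemma pabs_gt0 x : x != 0 -> 0 < a x.
Proof. by move=> x0; rewrite lt_def (pabs_eq0 ha) x0 (pabs_ge0 ha). Qed.

Lemma pabs1 : a 1 = 1.
Proof.
have a10 : a 1 != 0 by rewrite (pabs_eq0 ha) oner_eq0.
by apply: (mulfI a10); rewrite -(pabsM ha) !mulr1.
Qed.

Lemma pabsN x : a (- x) = a x.
Proof.
have /eqP := pabsM ha (-1) (-1); rewrite mulrNN mulr1 pabs1 -expr2 eq_sym.
rewrite sqrf_eq1 => /orP[/eqP e|/eqP e]; first by rewrite -mulN1r (pabsM ha) e mul1r.
by have := pabs_ge0 ha (-1); rewrite e lerNr oppr0 ler10.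
Qed.

Lemma pabsV x : a x^-1 = (a x)^-1.
Proof.
have [->|x0] := eqVneq x 0; first by rewrite invr0 pabs0 invr0.
have ax0 : a x != 0 by rewrite (pabs_eq0 ha).
by apply: (mulfI ax0); rewrite -(pabsM ha) !divff // pabs1.
Qed.

Lemma pabsX x n : a (x ^+ n) = a x ^+ n.
Proof. by elim: n => [|n IH]; rewrite ?pabs1 // !exprS (pabsM ha) IH. Qed.

Lemma pabs_prod (I : Type) (s : seq I) (P : pred I) (F : I -> K) :
  a (\prod_(i <- s | P i) F i) = \prod_(i <- s | P i) a (F i).
Proof. exact: (big_morph a (pabsM ha) pabs1). Qed.

Lemma pabs_leD x y B : a x <= B -> a y <= B -> a (x + y) <= B.
Proof.
by move=> xB yB; rewrite (le_trans (pabsD ha x y)) // ge_max xB yB.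
Qed.

Lemma pabs_leB x y B : a x <= B -> a y <= B -> a (x - y) <= B.
Proof. by move=> xB yB; apply: pabs_leD; rewrite ?pabsN. Qed.

Lemma pabs_sum (I : Type) (s : seq I) (P : pred I) (F : I -> K) B :
  0 <= B -> (forall i, P i -> a (F i) <= B) -> a (\sum_(i <- s | P i) F i) <= B.
Proof.
move=> B0 FB; elim/big_ind: _ => //; first by rewrite pabs0.
by move=> x y; exact: pabs_leD.
Qed.

Lemma pabs_nat n : a n%:R <= 1.
Proof. by elim: n => [|n IH]; rewrite ?pabs0 // -addn1 natrD pabs_leD // pabs1. Qed.

(** If [n] had absolute value below 1, a Bezout relation between [n] and [p] would give 1 an
    absolute value below 1. *)
Lemma pabs_coprime n : coprime p n -> 1 <= a n%:R.
Proof.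
move=> cpn.
have n0 : (0 < n)%N.
  by move: cpn (pp); case: n => //; rewrite /coprime gcdn0 => /eqP ->.
have [u u' e _] := egcdnP p n0.
move: e; rewrite gcdnC (eqP cpn) => e.
rewrite leNgt; apply/negP => an.
have : a 1 < 1; last by rewrite pabs1 ltxx.
have -> : 1 = (u * n)%:R - (u' * p)%:R :> K by rewrite e natrD addrC addKr.
apply: le_lt_trans (pabsD ha _ _) _; rewrite pabsN gt_max !natrM !(pabsM ha).
have lt1 x y : a x <= 1 -> a y < 1 -> a x * a y < 1.
  by move=> x1 y1; rewrite (le_lt_trans _ y1) // ler_piMl // (pabs_ge0 ha).
rewrite !lt1 ?pabs_nat // (pabs_p ha) invf_lt1 ?ltr1n ?prime_gt1 //.
by rewrite ltr0n prime_gt0.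
Qed.

Lemma logn_fact_le n : (logn p n`! <= n)%N.
Proof.
rewrite logn_fact //.
(* The remainder [n %/ p ^ m] carries the induction: since [p >= 2] it is at least twice the next
   quotient, which pays for both the new term and the new remainder. *)
suff H m : (\sum_(1 <= k < m.+1) n %/ p ^ k + n %/ p ^ m <= n)%N.
  exact: leq_trans (leq_addr _ _) (H n).
elim: m => [|m IH]; first by rewrite big_geq // expn0 divn1.
rewrite big_nat_recr //= -addnA; apply: leq_trans IH; rewrite leq_add2l.
rewrite addnn -muln2 expnSr divnMA.
apply: leq_trans (leq_trunc_div (n %/ p ^ m) p).
by rewrite leq_mul2l prime_gt1 ?orbT.
Qed.

(** The part of [n!] prime to [p] has absolute value at least 1, and the exponent of [p] in [n!] is
    at most [n]. *)
Lemma pabs_fact_ge n : p%:R ^- n <= a (n`!)%:R.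
Proof.
have [k cpk ->] := pfactor_coprime pp (fact_gt0 n).
rewrite natrM natrX (pabsM ha) pabsX (pabs_p ha).
have p0 : 0 < p%:R :> R by rewrite ltr0n prime_gt0.
have pk : (p%:R : R) ^- n <= p%:R ^- logn p n`!.
  rewrite lef_pV2 ?posrE ?exprn_gt0 // ler_eXn2l ?ltr1n ?prime_gt1 //.
  exact: logn_fact_le.
by rewrite exprVn (le_trans pk) // ler_peMl ?pabs_coprime.
Qed.

(** The value 1 at [k + l = 0] matches the term omitted from the series that defines the type; the
    floor at 1 keeps products from decreasing when factors are added. *)
Definition small_den (l : K) (k : nat) : R :=
  if k%:R + l == 0 then 1 else Num.max 1 (a (k%:R + l))^-1.

Lemma small_den_ge1 l k : 1 <= small_den l k.
Proof. by rewrite /small_den; case: ifP => // _; rewrite le_max lexx. Qed.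

Hypothesis natK0 : forall n, (0 < n)%N -> n%:R != 0 :> K.

(** When the left side exceeds 1, [n + l] is at least as large as [m + l] in absolute value, so the
    ultrametric inequality bounds their difference [m - n] by [n + l]. *)
Lemma small_den_dist l m n : m != n -> small_den l n <= small_den l m ->
  small_den l n <= (a (`|m - n|%N)%:R)^-1.
Proof.
move=> mn le_nm; have d0 : (0 < `|m - n|)%N by rewrite lt0n distn_eq0.
have ad0 : 0 < a (`|m - n|%N)%:R by exact/pabs_gt0/natK0.
have ge1 : 1 <= (a (`|m - n|%N)%:R)^-1 by rewrite invf_ge1 // pabs_nat.
have [le1|] := leP (small_den l n) 1; first exact: le_trans le1 ge1.
move: le_nm.
rewrite /small_den; case: (n%:R + l =P 0) => [_|/eqP n0]; first by rewrite ltxx.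
rewrite [1 < _]lt_max ltxx /= => + n1; rewrite (max_idPr (ltW n1)).
case: (m%:R + l =P 0) => [_|/eqP m0]; first by rewrite leNgt n1.
rewrite le_max leNgt n1 /= => nm.
have {nm} nm : a (m%:R + l) <= a (n%:R + l).
  by move: nm; rewrite lef_pV2 // posrE pabs_gt0.
rewrite lef_pV2 ?posrE ?pabs_gt0 ?natK0 //.
have sub i j : (i <= j)%N -> a (j - i)%:R = a (j%:R - i%:R).
  by move=> ij; rewrite natrB.
have -> : a (`|m - n|%N)%:R = a (m%:R - n%:R).
  have [le|/ltnW le] := leqP m n.
    by rewrite distnEr // sub // -pabsN opprB.
  by rewrite distnEl // sub.
have -> : m%:R - n%:R = (m%:R + l) - (n%:R + l) :> K by ring.
exact: pabs_leB.
Qed.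

(* The denominators other than the largest one, at [m], are bounded by the
   distances to [m], whose product is a product of two factorials dividing
   [N!]. *)
Lemma small_den_prod l (L : R) : 1 <= L ->
  (forall k, small_den l k <= L ^+ k.+1) ->
  forall N, \prod_(k < N.+1) small_den l k <= (L * p%:R) ^+ N.+1.
Proof.
move=> L1 hL N.
pose m := [arg max_(i > (ord0 : 'I_N.+1)) small_den l i]%O.
have mP (k : 'I_N.+1) : small_den l k <= small_den l m.
  rewrite /m; case: Order.TotalTheory.arg_maxP => //= i _ H; exact: H.
have mN : (m <= N)%N by rewrite -ltnS.
have dist : \prod_(k < N.+1 | k != m) (`|m - k|%N)%:R = (m`! * (N - m)`!)%:R :> K.
  rewrite -prod_dist // natr_prod big_mkord.
  by apply: eq_bigl => k.
rewrite (bigD1 m) //=.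
have lem : \prod_(k < N.+1 | k != m) small_den l k <= p%:R ^+ N.
  apply: (@le_trans _ _ (\prod_(k < N.+1 | k != m) (a (`|m - k|%N)%:R)^-1)).
    apply: ler_prod => k km; rewrite (le_trans ler01) ?small_den_ge1 //=.
    by rewrite small_den_dist // eq_sym.
  rewrite prodfV -pabs_prod dist.
  have := pabs_fact_ge N; rewrite -(bin_fact mN) natrM (pabsM ha) => H.
  have fgt0 : (0 < m`! * (N - m)`!)%N by rewrite muln_gt0 !fact_gt0.
  have {}H : p%:R ^- N <= a (m`! * (N - m)`!)%:R.
    by apply: le_trans H _; rewrite ler_piMl ?(pabs_ge0 ha) ?pabs_nat.
  rewrite -[leRHS]invrK lef_pV2 // posrE ?invr_gt0 ?exprn_gt0 ?ltr0n ?prime_gt0 //.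
  by rewrite pabs_gt0 // natK0.
rewrite exprMn.
have p1 : 1 <= p%:R :> R by rewrite ler1n prime_gt0.
apply: ler_pM.
- by rewrite (le_trans ler01) ?small_den_ge1.
- by apply: prodr_ge0 => k _; rewrite (le_trans ler01) ?small_den_ge1.
- by rewrite (le_trans (hL m)) // ler_weXn2l // ltnS.
- by rewrite (le_trans lem) // ler_weXn2l.
Qed.

End PadicAbs.

(** * Bounds for Sylvester equations *)

Lemma cvg0_le (R : realType) (u : nat -> R) :
  (fun n => u n : R^o) @ \oo --> (0 : R^o) ->
  exists2 C, 1 <= C & forall n, u n <= C.
Proof.
move=> cu; have : cvgn (u : nat -> R^o) by apply/cvg_ex; exists 0.
move/cvg_seq_bounded/pinfty_ex_gt0 => [C C0 hC].
exists (C + 1) => [|n]; first by rewrite lerDr ltW.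
by rewrite (le_trans (ler_norm _)) // (le_trans (hC n I)) // lerDl.
Qed.

(** Convergence on a small disc and geometric growth of the coefficients differ by a rescaling and a
    constant; the exponent [n.+1] lets [L] absorb the constant. *)
Lemma OdagP (R : realType) (p : nat) (E : fieldType) (v : E -> \bar R) (f : fps E) :
  prime p -> is_pabs p (nabs v p) ->
  Odag v p f <-> exists2 L, 1 <= L & forall n, nabs v p (fcoef f n) <= L ^+ n.+1.
Proof.
move=> pp ha; have p0 : 0 < p%:R :> R by rewrite ltr0n prime_gt0.
have aE s n : nabs v p (fcoef f n * p%:R ^+ (s * n)) =
    nabs v p (fcoef f n) / p%:R ^+ s ^+ n.
  by rewrite (pabsM ha) (pabsX ha) (pabs_p ha) exprVn exprM.
split=> [[s fs]|[L L1 hL]].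
  have [C C1 hC] := cvg0_le fs.
  have ps1 : 1 <= p%:R ^+ s :> R by rewrite exprn_ege1 // ler1n prime_gt0.
  exists (C * p%:R ^+ s) => [|n]; first by rewrite mulr_ege1.
  have := hC n; rewrite aE ler_pdivrMr ?exprn_gt0 // => /le_trans -> //.
  rewrite exprMn; apply: ler_pM; first exact: le_trans ler01 C1.
  - by rewrite exprn_ge0 // (le_trans ler01).
  - by rewrite ler_eXnr.
  - by rewrite ler_weXn2l.
(* With [L < p ^ s] the rescaled coefficients are dominated by [L (L / p ^ s) ^ n]. *)
have [s Ls] : exists s, L < p%:R ^+ s.
  exists (Num.bound L); have := archi_boundP (le_trans ler01 L1).
  move=> /lt_le_trans -> //.
  by rewrite -natrX ler_nat ltnW // ltn_expl // prime_gt1.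
have L0 : 0 < L by rewrite (lt_le_trans ltr01).
exists s; rewrite /tate.
have q1 : `|L / p%:R ^+ s| < 1.
  by rewrite ger0_norm ?divr_ge0 ?exprn_ge0 ?ltW // ltr_pdivrMr ?mul1r ?exprn_gt0.
apply: (squeeze_cvgr _ (cvg_cst 0) (cvg_geometric L q1)).
near=> n; rewrite aE divr_ge0 ?(pabs_ge0 ha) ?exprn_ge0 ?(ltW p0) //=.
rewrite /geometric /= expr_div_n mulrA -exprS ler_pM2r ?hL // invr_gt0 !exprn_gt0 //.
Unshelve. all: by end_near.
Qed.

(** A radius [rho > 0] at which the terms stay below [C] bounds the denominator at [k] by
    [C rho ^ -k]; the base [1 + rho^-1] is used instead of [rho^-1] because it is at least 1. *)
Lemma exptype_gt0_small_den (R : realType) (p : nat) (K : fieldType)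
    (v : K -> \bar R) (l : K) : is_pabs p (nabs v p) ->
  (0 < exptype v p (- l))%E ->
  exists2 L, 1 <= L & forall k, small_den (nabs v p) l k <= L ^+ k.+1.
Proof.
move=> ha /ereal_sup_gt[_ /= [rho [_ cv] <-]]; rewrite lte_fin => rho0.
have [C C1 hC] := cvg0_le cv.
have r0 : 0 < rho^-1 by rewrite invr_gt0.
have L1 : 1 <= C * (1 + rho^-1) by rewrite mulr_ege1 // lerDl ltW.
exists (C * (1 + rho^-1)) => // k.
rewrite /small_den; case: eqP => [_|/eqP kl]; first by rewrite exprn_ege1.
rewrite ge_max exprn_ege1 //=.
have := hC k; rewrite -subr_eq0 opprK (negbTE kl) (pabsV ha) -opprD (pabsN ha).
rewrite addrC -ler_pdivlMr ?exprn_gt0 // => /le_trans -> //.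
rewrite -exprVn exprMn; apply: ler_pM; first exact: le_trans ler01 C1.
- by rewrite exprn_ge0 // ltW.
- by rewrite ler_eXnr.
apply: (@le_trans _ _ ((1 + rho^-1) ^+ k)).
  by rewrite lerXn2r ?nnegrE ?addr_ge0 ?lerDr ?ltW.
by rewrite ler_weXn2l // lerDl ltW.
Qed.

(** * Ultrametric bounds for matrices *)

Section MatrixBounds.
Context (R : realType) (p : nat) (K : fieldType) (a : K -> R).
Hypothesis ha : is_pabs p a.

(** Because the absolute value is ultrametric, such entrywise bounds pass to sums and multiply under
    products with no factor depending on the size. *)
Definition mxle m n (A : 'M[K]_(m, n)) (B : R) := forall i j, a (A i j) <= B.

Lemma mxle_trans m n (A : 'M[K]_(m, n)) B B' : mxle A B -> B <= B' -> mxle A B'.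
Proof. by move=> AB BB i j; exact: le_trans (AB i j) BB. Qed.

Lemma mxle0 m n B : 0 <= B -> mxle (0 : 'M[K]_(m, n)) B.
Proof. by move=> B0 i j; rewrite mxE (pabs0 ha). Qed.

Lemma mxleD m n (A A' : 'M[K]_(m, n)) B :
  mxle A B -> mxle A' B -> mxle (A + A') B.
Proof. by move=> AB AB' i j; rewrite mxE; exact: (pabs_leD ha). Qed.

Lemma mxleN m n (A : 'M[K]_(m, n)) B : mxle A B -> mxle (- A) B.
Proof. by move=> AB i j; rewrite mxE (pabsN ha). Qed.

Lemma mxleB m n (A A' : 'M[K]_(m, n)) B :
  mxle A B -> mxle A' B -> mxle (A - A') B.
Proof. by move=> AB AB'; apply: mxleD => //; exact: mxleN. Qed.

Lemma mxle_sum m n (I : Type) (s : seq I) (P : pred I) (F : I -> 'M[K]_(m, n)) B :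
  0 <= B -> (forall i, P i -> mxle (F i) B) -> mxle (\sum_(i <- s | P i) F i) B.
Proof.
by move=> B0 FB; elim/big_ind: _ => //; [exact: mxle0|move=> A A'; exact: mxleD].
Qed.

Lemma mxleM m n q (A : 'M[K]_(m, n)) (A' : 'M[K]_(n, q)) B B' :
  0 <= B -> 0 <= B' -> mxle A B -> mxle A' B' -> mxle (A *m A') (B * B').
Proof.
move=> B0 B0' AB AB' i j; rewrite mxE; apply: (pabs_sum ha) => [|k _].
  exact: mulr_ge0.
by rewrite (pabsM ha) ler_pM ?(pabs_ge0 ha).
Qed.

Lemma mxle_scalar m c B : 0 <= B -> a c <= B -> mxle (c%:M : 'M[K]_m) B.
Proof. by move=> B0 cB i j; rewrite mxE; case: eqP => _; rewrite ?mulr1n ?(pabs0 ha). Qed.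

Lemma mxle_exists m n (A : 'M[K]_(m, n)) : exists2 B, 1 <= B & mxle A B.
Proof.
have s0 i : 0 <= \sum_j a (A i j) by rewrite sumr_ge0 // => j _; exact: pabs_ge0 ha _.
exists (1 + \sum_i \sum_j a (A i j)) => [|i j]; first by rewrite lerDl sumr_ge0.
rewrite (bigD1 i) //= (bigD1 j) //= addrCA -addrA lerDl !addr_ge0 ?sumr_ge0 //.
by move=> k _; exact: pabs_ge0 ha _.
Qed.

Lemma mxle_det m (A : 'M[K]_m) B : 1 <= B -> mxle A B -> a (\det A) <= B ^+ m.
Proof.
move=> B1 AB; have B0 := le_trans ler01 B1.
apply: (pabs_sum ha) => [|s _]; first exact: exprn_ge0.
rewrite (pabsM ha) (pabsX ha) (pabsN ha) (pabs1 ha) expr1n mul1r (pabs_prod ha).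
rewrite -[m in B ^+ m]card_ord -prodr_const ler_prod // => i _.
by rewrite (pabs_ge0 ha) AB.
Qed.

Lemma mxle_adj m (A : 'M[K]_m) B : 1 <= B -> mxle A B -> mxle (\adj A) (B ^+ m).
Proof.
move=> B1 AB i j; rewrite mxE (pabsM ha) (pabsX ha) (pabsN ha) (pabs1 ha).
rewrite expr1n mul1r (@le_trans _ _ (B ^+ m.-1)) ?ler_weXn2l ?leq_pred //.
by apply: mxle_det => // k l; rewrite !mxE.
Qed.

(** The bound is uniform in [k] because integers have absolute value at most 1. *)
Lemma horner_shift_bound m (A : 'M[K]_m.+1) (q : {poly K}) :
  exists2 C, 1 <= C & forall k : nat, mxle (horner_mx (k%:R%:M + A) q) C.
Proof.
have [B B1 AB] := mxle_exists A; have B0 := le_trans ler01 B1.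
elim/poly_ind: q => [|q c [C C1 hC]].
  by exists 1 => // k; rewrite rmorph0; exact: mxle0.
have C0 := le_trans ler01 C1.
exists (C * B + a c) => [|k].
  by rewrite (@le_trans _ _ (C * B)) ?mulr_ege1 ?lerDl ?(pabs_ge0 ha).
rewrite rmorphD rmorphM /= horner_mx_X horner_mx_C.
apply: mxleD.
  apply: (@mxle_trans _ _ _ (C * B)); last by rewrite lerDl (pabs_ge0 ha).
  apply: mxleM => //; apply: mxleD => //.
  by apply: mxle_scalar => //; rewrite (le_trans (pabs_nat ha k)).
by apply: mxle_scalar; rewrite ?addr_ge0 ?lerDr ?mulr_ge0 ?(pabs_ge0 ha).
Qed.

(* [X q(X)] is handled by
   [U q(U) Q - Q q(V) V = U (q(U) Q - Q q(V)) + (U Q - Q V) q(V)]. *)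
Lemma horner_intertwine_bound m s (A : 'M[K]_m.+1) (V : 'M[K]_s.+1) (q : {poly K}) :
  exists2 C, 1 <= C & forall (k : nat) (Q : 'M[K]_(m.+1, s.+1)) t, 0 <= t ->
    mxle ((k%:R%:M + A) *m Q - Q *m V) t ->
    mxle (horner_mx (k%:R%:M + A) q *m Q - Q *m horner_mx V q) (C * t).
Proof.
have [B B1 AB] := mxle_exists A; have B0 := le_trans ler01 B1.
elim/poly_ind: q => [|q c [C C1 hC]].
  exists 1 => // k Q t t0 _; rewrite !rmorph0 mul0mx mulmx0 subr0.
  by apply: mxle0; rewrite mul1r.
have C0 := le_trans ler01 C1.
have [D D1 hD] := mxle_exists (horner_mx V q); have D0 := le_trans ler01 D1.
exists (B * C + D) => [|k Q t t0 hQ].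
  by rewrite (@le_trans _ _ (B * C)) ?mulr_ege1 ?lerDl.
set U := k%:R%:M + A in hQ *.
have UB : mxle U B.
  apply: mxleD => //.
  by apply: mxle_scalar => //; rewrite (le_trans (pabs_nat ha k)).
rewrite !rmorphD !rmorphM /= !horner_mx_X !horner_mx_C.
have -> : (horner_mx U q * U + c%:M) *m Q - Q *m (horner_mx V q * V + c%:M) =
    U *m (horner_mx U q *m Q - Q *m horner_mx V q) +
    (U *m Q - Q *m V) *m horner_mx V q.
  have cU : horner_mx U q * U = U *m horner_mx U q.
    exact: (comm_horner_mx q (erefl (U *m U))).
  have cV : horner_mx V q * V = V *m horner_mx V q.
    exact: (comm_horner_mx q (erefl (V *m V))).
  rewrite cU cV [in LHS]mulmxDl [in LHS]mulmxDr mul_scalar_mx mul_mx_scalar.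
  rewrite opprD addrACA subrr addr0.
  by rewrite mulmxBr mulmxBl !mulmxA addrA subrK.
apply: mxleD.
  apply: (@mxle_trans _ _ _ (B * (C * t))).
    by apply: mxleM; rewrite ?mulr_ge0 //; exact: hC.
  by rewrite mulrDl mulrA lerDl mulr_ge0.
apply: (@mxle_trans _ _ _ (t * D)); first exact: mxleM.
by rewrite mulrDl (mulrC t) lerDr !mulr_ge0.
Qed.

End MatrixBounds.

Lemma char_poly_horner (R : comNzRingType) n (A : 'M[R]_n) x :
  (char_poly A).[x] = \det (x%:M - A).
Proof.
rewrite -[_.[x]]/(horner_eval x _) -det_map_mx; congr (\det _).
apply/matrixP => i j; rewrite !mxE /= horner_evalE hornerD hornerN hornerC.
by case: eqP => _; rewrite ?mulr1n ?mulr0n ?hornerX ?horner0.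
Qed.

Lemma det_shift_eigen (E F : fieldType) (iota : {rmorphism E -> F}) m
    (A : 'M[E]_m) (lam : 'I_m -> F) x :
  map_poly iota (char_poly A) = \prod_i ('X - (lam i)%:P) ->
  \det (x%:M + map_mx iota A) = \prod_i (x + lam i).
Proof.
move=> hA; have -> : x%:M + map_mx iota A = (-1) *: ((- x)%:M - map_mx iota A).
  by rewrite scaleN1r opprB raddfN opprK addrC.
rewrite detZ -char_poly_horner -map_char_poly hA horner_prod.
rewrite -[m in (-1) ^+ m]card_ord -prodr_const -big_split /=.
by apply: eq_bigr => i _; rewrite !hornerE mulN1r opprB opprK addrC.
Qed.

(** * Inverting Sylvester operators *)

Section Sylvester.
Context (R : realType) (p : nat) (E F : fieldType) (a : E -> R) (b : F -> R).
Context (iota : {rmorphism E -> F}).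
Hypotheses (ha : is_pabs p a) (hb : is_pabs p b).
Hypothesis hab : forall x, b (iota x) = a x.

(** Over [F] the characteristic polynomial of [V] splits, so the matrix is the product over [j] of
    the [k - mu j + A], and each determinant is read off from the eigenvalues of [A]. *)
Lemma det_horner_char_poly m s (A : 'M[E]_m.+1) (V : 'M[E]_s)
    (lam : 'I_m.+1 -> F) (mu : 'I_s -> F) (k : nat) :
  map_poly iota (char_poly A) = \prod_i ('X - (lam i)%:P) ->
  map_poly iota (char_poly V) = \prod_i ('X - (mu i)%:P) ->
  iota (\det (horner_mx (k%:R%:M + A) (char_poly V))) =
    \prod_j \prod_i (k%:R + (lam i - mu j)).
Proof.
move=> hA hV; rewrite -det_map_mx map_horner_mx hV rmorph_prod /=.
rewrite (big_morph (fun M : 'M[F]_m.+1 => \det M) (@det_mulmx _ _) (@det1 _ _)).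
apply: eq_bigr => j _; rewrite rmorphB /= horner_mx_X horner_mx_C.
rewrite map_mxD map_scalar_mx rmorph_nat addrAC -raddfB (det_shift_eigen _ hA).
by apply: eq_bigr => i _; rewrite addrAC addrA.
Qed.

Lemma sylvester_bound m s (A : 'M[E]_m) (V : 'M[E]_s)
    (lam : 'I_m -> F) (mu : 'I_s -> F) :
  map_poly iota (char_poly A) = \prod_i ('X - (lam i)%:P) ->
  map_poly iota (char_poly V) = \prod_i ('X - (mu i)%:P) ->
  exists2 C, 1 <= C & forall (k : nat) (Q : 'M[E]_(m, s)) t, 0 <= t ->
    (forall i j, k%:R + (lam i - mu j) != 0) ->
    mxle a (k%:R *: Q + A *m Q - Q *m V) t ->
    mxle a Q (C * (\prod_j \prod_i small_den b (lam i - mu j) k) * t).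
Proof.
(* Empty matrices are set aside because Horner evaluation takes place in a ring of matrices of
   positive size. *)
case: m A lam => [|m] A lam; first by exists 1 => // k Q t _ _ _ [].
case: s V mu => [|s] V mu; first by exists 1 => // k Q t _ _ _ i [].
move=> hA hV; set chi := char_poly V.
have [C C1 hC] := horner_shift_bound ha A chi.
have [D D1 hD] := horner_intertwine_bound ha A V chi.
exists (C ^+ m.+1 * D) => [|k Q t t0 nz]; first by rewrite mulr_ege1 ?exprn_ege1.
rewrite -mul_scalar_mx -mulmxDl => /(hD k Q t t0).
rewrite Cayley_Hamilton mulmx0 subr0; set Z := horner_mx _ _ => hZ i j.
have hdet := det_horner_char_poly k hA hV.
have dE : a (\det Z) = \prod_j \prod_i b (k%:R + (lam i - mu j)).
  rewrite -hab hdet (pabs_prod hb); apply: eq_bigr => l _.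
  exact: (pabs_prod hb).
have pos l h : 0 < b (k%:R + (lam l - mu h)) by rewrite (pabs_gt0 hb) ?nz.
have d0 : 0 < a (\det Z).
  by rewrite dE prodr_gt0 // => l _; rewrite prodr_gt0.
have small : (a (\det Z))^-1 <= \prod_j \prod_i small_den b (lam i - mu j) k.
  rewrite dE -prodfV; apply: ler_prod => l _.
  rewrite -prodfV prodr_ge0 => [|h _]; last by rewrite invr_ge0 ltW.
  apply: ler_prod => h _; rewrite invr_ge0 ltW //= /small_den (negbTE (nz _ _)).
  by rewrite le_max lexx orbT.
have C0 := le_trans ler01 C1; have D0 := le_trans ler01 D1.
(* The adjugate recovers [Q] from [Z *m Q] up to the factor [\det Z], whose absolute value is known
   exactly. *)
have : a (\det Z) * a (Q i j) <= C ^+ m.+1 * (D * t).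
  rewrite -(pabsM ha).
  have -> : \det Z * Q i j = (\adj Z *m (Z *m Q)) i j.
    by rewrite mulmxA mul_adj_mx mul_scalar_mx mxE.
  apply: (mxleM ha _ _ (mxle_adj ha C1 (hC k)) hZ); first exact: exprn_ge0.
  exact: mulr_ge0.
rewrite -ler_pdivlMl // => /le_trans; apply.
rewrite [leRHS]mulrAC [leRHS]mulrC -!mulrA.
by rewrite ler_wpM2r // !mulr_ge0 // exprn_ge0.
Qed.

(** The operator acts on a finite-dimensional space, so injectivity suffices, and this is
    [sylvester_bound] with [t = 0]. *)
Lemma sylvester_surj m s (A : 'M[E]_m) (V : 'M[E]_s)
    (lam : 'I_m -> F) (mu : 'I_s -> F) (k : nat) :
  map_poly iota (char_poly A) = \prod_i ('X - (lam i)%:P) ->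
  map_poly iota (char_poly V) = \prod_i ('X - (mu i)%:P) ->
  (forall i j, k%:R + (lam i - mu j) != 0) ->
  forall T : 'M[E]_(m, s), exists Q, k%:R *: Q + A *m Q - Q *m V = T.
Proof.
move=> hA hV nz T; have [C C1 hC] := sylvester_bound hA hV.
pose L : 'M[E]_(m * s) := k%:R%:M + lin_mulmx A - lin_mulmxr V.
have LE Q : mxvec Q *m L = mxvec (k%:R *: Q + A *m Q - Q *m V).
  by rewrite mulmxBr mulmxDr mul_mx_scalar !mul_vec_lin /= linearB linearD linearZ.
have Lu : L \in unitmx.
  rewrite -row_free_unit; apply/inj_row_free => u.
  rewrite -[u]vec_mxK LE => /(congr1 vec_mx); rewrite mxvecK linear0 => e.
  suff -> : vec_mx u = 0 :> 'M_(m, s) by rewrite linear0.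
  apply/matrixP => i j; rewrite [RHS]mxE; apply/eqP; rewrite -(pabs_eq0 ha).
  rewrite eq_le (pabs_ge0 ha) andbT.
  have /hC : mxle a (k%:R *: vec_mx u + A *m vec_mx u - vec_mx u *m V) 0.
    by rewrite e; exact: (mxle0 ha).
  by move=> /(_ (lexx 0) nz i j); rewrite mulr0.
exists (vec_mx (mxvec T *m invmx L)).
by apply: (can_inj mxvecK); rewrite -LE vec_mxK mulmxKV.
Qed.

End Sylvester.

(** * Formal and convergent solutions *)

Lemma strong_recursion (T : Type) (x0 : T) (G : nat -> (nat -> T) -> T) :
  (forall k u w, (forall i, (i < k)%N -> u i = w i) -> G k u = G k w) ->
  exists u, forall k, u k = G k u.
Proof.
move=> extG.
(* [hist k] is correct below [k] and equal to [x0] from [k] on; [extG] ensures that [G k] reads only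
   the correct part. *)
pose hist := fix hist k : nat -> T :=
  if k is k'.+1 then
    fun i => if i == k' then G k' (hist k') else hist k' i
  else fun=> x0.
have histS k i : (i < k)%N -> hist k i = hist i.+1 i.
  elim: k => // k IH; rewrite ltnS leq_eqVlt => /predU1P[->//|ik].
  by rewrite /= ltn_eqF // eqxx IH //= eqxx.
exists (fun k => hist k.+1 k) => k /=; rewrite eqxx; apply: extG => i.
exact: histS.
Qed.

Lemma prodr_ege1 (R : realType) (I : Type) (r : seq I) (P : pred I) (F : I -> R) :
  (forall i, P i -> 1 <= F i) -> 1 <= \prod_(i <- r | P i) F i.
Proof. by move=> F1; elim/big_ind: _ => // x y; exact: mulr_ege1. Qed.

Lemma finite_ub (R : realType) (I : finType) (F : I -> R) :
  exists2 L, 1 <= L & forall i, F i <= L.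
Proof.
exists (1 + \sum_i `|F i|) => [|i]; first by rewrite lerDl sumr_ge0.
rewrite (bigD1 i) //= addrCA (le_trans (ler_norm _)) // lerDl addr_ge0 //.
exact: sumr_ge0.
Qed.

(** In characteristic 0 each [x i] excludes at most one [k]. *)
Lemma eventually_nat_add_neq0 (F : fieldType) (I : finType) (x : I -> F) :
  (forall n, (0 < n)%N -> n%:R != 0 :> F) ->
  exists n0, forall k, (n0 <= k)%N -> forall i, k%:R + x i != 0.
Proof.
move=> natF0.
have /choice[N hN] i : exists n0, forall k, (n0 <= k)%N -> k%:R + x i != 0.
  have [[k0 /eqP h]|h] := pselect (exists k : nat, k%:R + x i == 0); last first.
    by exists 0%N => k _; apply/negP => kx; apply: h; exists k.
  exists k0.+1 => k k0k; have -> : x i = - k0%:R.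
    by apply/eqP; rewrite -addr_eq0 addrC h.
  by rewrite -natrB ?natF0 ?subn_gt0 // ltnW.
exists (\max_i N i)%N => k Nk i; apply: hN; apply: leq_trans Nk.
exact: leq_bigmax.
Qed.

(** * Coefficients of matrices of power series *)

Section SeriesMatrices.
Context (E : fieldType).

Definition cmx m s (n : nat) (P : 'M[fps E]_(m, s)) : 'M[E]_(m, s) :=
  map_mx (fun f => fcoef f n) P.

Definition fps_theta (f : fps E) := fpsz * fps_deriv f.

Definition thetamx m s (P : 'M[fps E]_(m, s)) := map_mx fps_theta P.

Definition mxseries m s (u : nat -> 'M[E]_(m, s)) : 'M[fps E]_(m, s) :=
  \matrix_(i, j) Fps (fun n => u n i j).

Lemma fcoefM (f g : fps E) n :
  fcoef (f * g) n = \sum_(i < n.+1) fcoef f i * fcoef g (n - i).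
Proof. by []. Qed.

Lemma fcoef_sum (I : Type) (s : seq I) (P : pred I) (F : I -> fps E) n :
  fcoef (\sum_(i <- s | P i) F i) n = \sum_(i <- s | P i) fcoef (F i) n.
Proof.
apply: (big_morph (fun f => fcoef f n)) => //.
by case: n.
Qed.

Lemma fcoef_zM (f : fps E) n :
  fcoef (fpsz * f) n = if n is k.+1 then fcoef f k else 0.
Proof.
rewrite fcoefM; case: n => [|n]; first by rewrite big_ord1 mul0r.
rewrite big_ord_recl big_ord_recl /= mul0r add0r mul1r subn1 /= big1 ?addr0 //.
by move=> i _; rewrite /= mul0r.
Qed.

Lemma fcoef_theta (f : fps E) n : fcoef (fps_theta f) n = n%:R * fcoef f n.
Proof. by rewrite fcoef_zM; case: n => [|n]; rewrite ?mul0r //= mulr_natl. Qed.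

Lemma cmxP m s (P Q : 'M[fps E]_(m, s)) : (forall n, cmx n P = cmx n Q) -> P = Q.
Proof.
move=> PQ; apply/matrixP => i j; apply: fpsP => n.
by have /matrixP/(_ i j) := PQ n; rewrite !mxE.
Qed.

Lemma cmxD m s n (P Q : 'M[fps E]_(m, s)) : cmx n (P + Q) = cmx n P + cmx n Q.
Proof. by apply/matrixP => i j; rewrite !mxE. Qed.

Lemma cmxB m s n (P Q : 'M[fps E]_(m, s)) : cmx n (P - Q) = cmx n P - cmx n Q.
Proof. by apply/matrixP => i j; rewrite !mxE. Qed.

Lemma cmx0 m s n : cmx n (0 : 'M[fps E]_(m, s)) = 0.
Proof. by apply/matrixP => i j; rewrite !mxE /=; case: n. Qed.

Lemma cmx1 m n : cmx n (1%:M : 'M[fps E]_m) = (n == 0%N)%:R%:M.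
Proof.
by apply/matrixP => i j; rewrite !mxE /=; case: n => [|n] /=; case: eqP.
Qed.

Lemma cmx_theta m s n (P : 'M[fps E]_(m, s)) : cmx n (thetamx P) = n%:R *: cmx n P.
Proof. by apply/matrixP => i j; rewrite !mxE fcoef_theta. Qed.

Lemma cmx_series m s n (u : nat -> 'M[E]_(m, s)) : cmx n (mxseries u) = u n.
Proof. by apply/matrixP => i j; rewrite !mxE. Qed.

Lemma cmxM m q s n (P : 'M[fps E]_(m, q)) (Q : 'M[fps E]_(q, s)) :
  cmx n (P *m Q) = \sum_(i < n.+1) cmx i P *m cmx (n - i) Q.
Proof.
apply/matrixP => i j; rewrite !mxE fcoef_sum summxE.
under eq_bigr do rewrite fcoefM; rewrite exchange_big /=.
by apply: eq_bigr => k _; rewrite !mxE; apply: eq_bigr => l _; rewrite !mxE.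
Qed.

Lemma cmxMr m q s n (P : 'M[fps E]_(m, q)) (Q : 'M[fps E]_(q, s)) :
  cmx n (P *m Q) = \sum_(i < n) cmx (n - i) P *m cmx i Q + cmx 0 P *m cmx n Q.
Proof.
rewrite cmxM (reindex_inj rev_ord_inj) big_ord_recr /= subSS subnn subn0.
congr (_ + _); apply: eq_bigr => i _; rewrite subSS subKn //.
exact: ltnW.
Qed.

(** In degree [k] the coefficient [cmx k Y] occurs only under a Sylvester operator shifted by [k];
    the remaining sum involves lower coefficients of [Y]. This is the recursion behind both the
    formal and the convergent solutions. *)
Lemma cmx_connection m s k (A : 'M[fps E]_m) (V : 'M[fps E]_s) Y :
  cmx k (thetamx Y + A *m Y - Y *m V) =
  (k%:R *: cmx k Y + cmx 0 A *m cmx k Y - cmx k Y *m cmx 0 V) +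
  \sum_(i < k) (cmx (k - i) A *m cmx i Y - cmx i Y *m cmx (k - i) V).
Proof.
rewrite cmxB cmxD cmx_theta cmxMr cmxM big_ord_recr /= subnn sumrB.
set u := k%:R *: _; set w := _ *m cmx k Y; set x := _ *m cmx 0 V.
set S := \sum_(i < k) _; set T := \sum_(i < k) _.
by rewrite (addrC S) (addrC T) opprD [u + (w + S)]addrA addrACA.
Qed.

(** With constant term 1, the coefficients of the inverse are determined one after the other without
    any division. *)
Lemma mxseries_unit m (P : 'M[fps E]_m) : cmx 0 P = 1%:M ->
  exists Q, P *m Q = 1%:M.
Proof.
move=> P0; pose G k (u : nat -> 'M[E]_m) :=
  cmx k 1%:M - \sum_(i < k) cmx (k - i) P *m u i.
have [|u hu] := @strong_recursion _ (0 : 'M[E]_m) G.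
  by move=> k u w uw; congr (_ - _); apply: eq_bigr => i _; rewrite uw.
exists (mxseries u); apply: cmxP => k; rewrite cmxMr P0 mul1mx cmx_series hu.
by under eq_bigr do rewrite cmx_series; rewrite addrC subrK.
Qed.

End SeriesMatrices.

(** * The connection equation, degree by degree *)

Section Connections.
Context (R : realType) (p : nat) (E F : fieldType) (a : E -> R) (b : F -> R).
Context (iota : {rmorphism E -> F}).
Hypotheses (pp : prime p) (ha : is_pabs p a) (hb : is_pabs p b).
Hypothesis hab : forall x, b (iota x) = a x.
Hypothesis natF0 : forall n, (0 < n)%N -> n%:R != 0 :> F.

(** Below [n0] the operator may be singular, so [Y] is set to 0 there and the equation is claimed
    only from degree [n0] on. *)
Lemma formal_solution m s (A : 'M[fps E]_m) (V : 'M[fps E]_s)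
    (lam : 'I_m -> F) (mu : 'I_s -> F) n0 (B : 'M[fps E]_(m, s)) :
  map_poly iota (char_poly (cmx 0 A)) = \prod_i ('X - (lam i)%:P) ->
  map_poly iota (char_poly (cmx 0 V)) = \prod_i ('X - (mu i)%:P) ->
  (forall k, (n0 <= k)%N -> forall i j, k%:R + (lam i - mu j) != 0) ->
  exists Y, (forall k, (k < n0)%N -> cmx k Y = 0) /\
    forall k, (n0 <= k)%N -> cmx k (thetamx Y + A *m Y - Y *m V) = cmx k B.
Proof.
move=> hA hV nz.
(* [S] chooses a preimage for each degree and right-hand side; it is unconstrained below [n0]. *)
have /choice[S hS] (kT : nat * 'M[E]_(m, s)) : exists Q, (n0 <= kT.1)%N ->
    kT.1%:R *: Q + cmx 0 A *m Q - Q *m cmx 0 V = kT.2.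
  have [le|_] := leqP n0 kT.1; last by exists 0.
  by have [Q hQ] := sylvester_surj ha hb hab hA hV (nz _ le) kT.2; exists Q.
pose G k (u : nat -> 'M[E]_(m, s)) := if (k < n0)%N then 0 else
  S (k, cmx k B - \sum_(i < k) (cmx (k - i) A *m u i - u i *m cmx (k - i) V)).
have [|u hu] := @strong_recursion _ (0 : 'M[E]_(m, s)) G.
  move=> k u w uw; rewrite /G; case: ifP => // _.
  by congr (S (_, _ - _)); apply: eq_bigr => i _; rewrite uw.
exists (mxseries u); split=> [k kn|k kn]; first by rewrite cmx_series hu /G kn.
rewrite cmx_connection !cmx_series.
under eq_bigr do rewrite cmx_series.
have := hu k; rewrite /G ltnNge kn /=; set T := _ - _ => uk.
by have := hS (k, T) kn; rewrite -uk /= => ->; rewrite subrK.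
Qed.

Definition geom_mx m s (P : 'M[fps E]_(m, s)) :=
  exists2 L, 1 <= L & forall n, mxle a (cmx n P) (L ^+ n.+1).

Lemma geom_mx_entries m s (P : 'M[fps E]_(m, s)) :
  (forall i j, exists2 L, 1 <= L & forall n, a (fcoef (P i j) n) <= L ^+ n.+1) ->
  geom_mx P.
Proof.
move=> hP.
have /choice[L hL] (ij : 'I_m * 'I_s) : exists L, 1 <= L /\
    forall n, a (fcoef (P ij.1 ij.2) n) <= L ^+ n.+1.
  by have [L ? ?] := hP ij.1 ij.2; exists L.
have [B B1 hB] := finite_ub L; exists B => // n i j; rewrite mxE.
have [L1 h] := hL (i, j); apply: le_trans (h n) _.
by rewrite lerXn2r ?nnegrE ?(le_trans ler01) // hB.
Qed.

(** By induction, [cmx k Y] is bounded by a geometric term times the product [Pi k.+1] of all small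
    denominators up to degree [k]. Each degree costs a single new factor [D k], and the whole
    product is again geometric. *)
Lemma geom_solution m s (A : 'M[fps E]_m) (V : 'M[fps E]_s)
    (lam : 'I_m -> F) (mu : 'I_s -> F) (Y : 'M[fps E]_(m, s)) :
  map_poly iota (char_poly (cmx 0 A)) = \prod_i ('X - (lam i)%:P) ->
  map_poly iota (char_poly (cmx 0 V)) = \prod_i ('X - (mu i)%:P) ->
  (forall i j, exists2 L, 1 <= L &
     forall k, small_den b (lam i - mu j) k <= L ^+ k.+1) ->
  geom_mx A -> geom_mx V -> geom_mx (thetamx Y + A *m Y - Y *m V) -> geom_mx Y.
Proof.
move=> hA hV hden [LA LA1 bA] [LV LV1 bV] [LX LX1 bX].
have [n0 nz] := @eventually_nat_add_neq0 F _
  (fun ij : 'I_m * 'I_s => lam ij.1 - mu ij.2) natF0.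
have [C C1 hC] := sylvester_bound ha hb hab hA hV.
pose D k := \prod_j \prod_i small_den b (lam i - mu j) k.
have D1 k : 1 <= D k.
  by apply: prodr_ege1 => j _; apply: prodr_ege1 => i _; exact: small_den_ge1.
pose Pi k := \prod_(l < k) D l.
have PiS k : Pi k.+1 = Pi k * D k by rewrite /Pi big_ord_recr.
have Pi1 k : 1 <= Pi k by apply: prodr_ege1.
have Pile i j : (i <= j)%N -> Pi i <= Pi j.
  elim: j => [|j IH]; first by rewrite leqn0 => /eqP ->.
  rewrite leq_eqVlt => /predU1P[-> //|/IH /le_trans ->] //.
  by rewrite PiS ler_peMr // (le_trans ler01).
(* Exchanging the products reduces the bound on [Pi] to [small_den_prod] for each pair of
   eigenvalues. *)
have [H H1 PiH] : exists2 H, 1 <= H & forall k, Pi k.+1 <= H ^+ k.+1.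
  have /choice[L hL] (ij : 'I_m * 'I_s) : exists L, 1 <= L /\
      forall k, small_den b (lam ij.1 - mu ij.2) k <= L ^+ k.+1.
    by have [L ? ?] := hden ij.1 ij.2; exists L.
  have p1 : 1 <= p%:R :> R by rewrite ler1n prime_gt0.
  exists (\prod_j \prod_i (L (i, j) * p%:R)) => [|k].
    apply: prodr_ege1 => j _; apply: prodr_ege1 => i _.
    by rewrite mulr_ege1 //; case: (hL (i, j)).
  rewrite /Pi /D exchange_big /= -prodrXl; apply: ler_prod => j _.
  rewrite exchange_big /= -prodrXl; apply/andP; split.
    do 2![apply: prodr_ge0 => ? _]; exact: le_trans ler01 (small_den_ge1 _ _ _).
  apply: ler_prod => i _; apply/andP; split.
    by apply: prodr_ge0 => ? _; exact: le_trans ler01 (small_den_ge1 _ _ _).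
  by have [? ?] := hL (i, j); exact: (small_den_prod pp hb natF0).
(* The finitely many degrees where the operator may be singular enter only through this constant. *)
have [N N1 hN] : exists2 N, 1 <= N & forall k, (k < n0)%N -> mxle a (cmx k Y) N.
  have /choice[B hB] (k : 'I_n0) : exists B, mxle a (cmx k Y) B.
    by have [B _ hB] := mxle_exists ha (cmx k Y); exists B.
  have [N N1 hN] := finite_ub B; exists N => // k kn.
  exact: mxle_trans (hB (Ordinal kn)) (hN _).
pose L := LA * LV * LX.
have L1 : 1 <= L by rewrite !mulr_ege1.
have [L0 C0 N0] : [/\ 0 <= L, 0 <= C & 0 <= N] by split; apply: le_trans ler01 _.
have bound (M : R) m' s' (P : 'M[fps E]_(m', s')) :
    1 <= M -> (forall n, mxle a (cmx n P) (M ^+ n.+1)) -> M <= L ->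
    forall n, mxle a (cmx n P) (L ^+ n.+1).
  move=> M1 hM ML n; apply: mxle_trans (hM n) _.
  by rewrite lerXn2r ?nnegrE // (le_trans ler01).
have LAL : LA <= L by rewrite /L -mulrA ler_peMr ?mulr_ege1 // (le_trans ler01).
have LVL : LV <= L.
  by rewrite /L mulrC mulrA ler_peMl ?mulr_ege1 // (le_trans ler01).
have LXL : LX <= L by rewrite /L ler_peMl ?mulr_ege1 // (le_trans ler01).
have {}bA := bound _ _ _ _ LA1 bA LAL.
have {}bV := bound _ _ _ _ LV1 bV LVL.
have {}bX := bound _ _ _ _ LX1 bX LXL.
(* The square of [L] is there because [d.+1 <= 2 d] for [d > 0]: then [C * L ^+ d.+1 <= G ^+ d], so
   [G] absorbs both the operator constant and the convolution. *)
clearbody L; pose G := C * L ^+ 2 * N.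
have G1 : 1 <= G by rewrite !mulr_ege1 ?exprn_ege1.
have G0 := le_trans ler01 G1.
have NG : N <= G by rewrite /G ler_peMl // mulr_ege1 ?exprn_ege1.
have CLG d : (0 < d)%N -> C * L ^+ d.+1 <= G ^+ d.
  move=> d0; apply: (@le_trans _ _ ((C * L ^+ 2) ^+ d)); last first.
    by rewrite lerXn2r ?nnegrE // ?ler_peMr // mulr_ge0 // exprn_ge0.
  rewrite exprMn -exprM ler_pM ?exprn_ge0 //; first by rewrite ler_eXnr.
  by rewrite ler_weXn2l // mul2n -addnn -addn1 leq_add2l.
clearbody G; suff main k : mxle a (cmx k Y) (G ^+ k.+1 * Pi k.+1).
  exists (G * H) => [|k]; first by rewrite mulr_ege1.
  apply: mxle_trans (main k) _.
  by rewrite exprMn ler_wpM2l ?exprn_ge0.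
elim/ltn_ind: k => k IH.
have [kn|kn] := ltnP k n0.
  apply: mxle_trans (hN k kn) _; apply: (le_trans NG).
  rewrite (@le_trans _ _ (G ^+ k.+1)) ?ler_eXnr // ler_peMr // exprn_ge0 //.
(* [t] is the target bound divided by [C * D k], so the Sylvester bound returns exactly the
   target. *)
pose t := G ^+ k.+1 * Pi k / C.
have Cgt0 : 0 < C by rewrite (lt_le_trans ltr01).
have Pi0 l : 0 <= Pi l by rewrite (le_trans ler01).
have t0 : 0 <= t by rewrite divr_ge0 // mulr_ge0 ?exprn_ge0.
have -> : G ^+ k.+1 * Pi k.+1 = C * D k * t.
  by rewrite PiS /t; field; rewrite gt_eqF.
apply: hC => // [i j|]; first exact: (nz k kn (i, j)).
have := bX k; rewrite cmx_connection.
set S := \sum_(i < k) _; set W := _ - _ => hW.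
have -> : W = (W + S) - S by rewrite addrK.
apply: (mxleB ha).
  apply: mxle_trans hW _; rewrite /t ler_pdivlMr // mulrC.
  rewrite (@le_trans _ _ (G ^+ k.+1)) //; last by rewrite ler_peMr // exprn_ge0.
  rewrite (le_trans _ (CLG k.+1 _)) // ler_wpM2l // ler_weXn2l //.
apply: (mxle_sum ha) => // i _; have ik := ltn_ord i.
(* The exponent splits as [k.+1 = (k - i) + i.+1] with [k - i > 0], and [Pi i.+1 <= Pi k] because
   [i < k]. *)
have key : L ^+ (k - i).+1 * (G ^+ i.+1 * Pi i.+1) <= t.
  rewrite /t ler_pdivlMr // mulrC !mulrA ler_pM ?mulr_ge0 ?exprn_ge0 ?Pile //.
  have -> : k.+1 = ((k - i) + i.+1)%N by rewrite addnS subnK // ltnW.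
  by rewrite exprD ler_wpM2r ?exprn_ge0 // CLG // subn_gt0.
apply: (mxleB ha).
  apply: mxle_trans key; apply: (mxleM ha); rewrite ?mulr_ge0 ?exprn_ge0 //.
  exact: IH.
rewrite mulrC in key; apply: mxle_trans key.
by apply: (mxleM ha); rewrite ?mulr_ge0 ?exprn_ge0 //; exact: IH.
Qed.

End Connections.

(** * Bases and fibres *)

Section Combinations.
Context (A : comNzRingType) (M : lmodType A).

Definition comb n (b : 'I_n -> M) (c : 'cV[A]_n) : M := \sum_i c i 0 *: b i.

(** The row of vectors [b] times the matrix [P]: column [j] holds the coordinates of the new vector
    [j]. *)
Definition bmul n m (b : 'I_n -> M) (P : 'M[A]_(n, m)) (j : 'I_m) : M :=
  \sum_i P i j *: b i.

Lemma bmulE n m (b : 'I_n -> M) (P : 'M[A]_(n, m)) j :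
  bmul b P j = comb b (col j P).
Proof. by apply: eq_bigr => i _; rewrite mxE. Qed.

Lemma comb_bmul n m (b : 'I_n -> M) (P : 'M[A]_(n, m)) c :
  comb (bmul b P) c = comb b (P *m c).
Proof.
rewrite /comb /bmul; under eq_bigr do rewrite scaler_sumr.
rewrite exchange_big /=; apply: eq_bigr => i _; rewrite mxE scaler_suml.
by apply: eq_bigr => j _; rewrite scalerA mulrC.
Qed.

Lemma bmulM n m q (b : 'I_n -> M) (P : 'M[A]_(n, m)) (Q : 'M[A]_(m, q)) :
  bmul (bmul b P) Q =1 bmul b (P *m Q).
Proof. by move=> j; rewrite !bmulE comb_bmul !colE mulmxA. Qed.

Lemma is_basisP n (b : 'I_n -> M) :
  is_basis b <-> injective (comb b) /\ forall x, exists c, x = comb b c.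
Proof.
split=> [hb|[inj surj] x].
  split=> [c d cd|x].
    have [e [_ ue]] := hb (comb b c).
    have /matrixP ed : \col_i e i = d.
      apply/matrixP => i j; rewrite mxE (ord1 j).
      rewrite (ue [ffun i => d i 0]) ?ffunE // cd.
      by apply: eq_bigr => k _; rewrite ffunE.
    apply/matrixP => i j; rewrite -ed mxE (ord1 j).
    rewrite (ue [ffun i => c i 0]) ?ffunE //.
    by apply: eq_bigr => k _; rewrite ffunE.
  have [e [ex _]] := hb x; exists (\col_i e i).
  by rewrite ex; apply: eq_bigr => i _; rewrite mxE.
have [c xc] := surj x; exists [ffun i => c i 0]; split.
  by rewrite xc; apply: eq_bigr => i _; rewrite ffunE.
move=> d xd; apply/ffunP => i; rewrite ffunE.
have -> : c = \col_i d i; last by rewrite mxE.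
by apply: inj; rewrite -xc xd; apply: eq_bigr => j _; rewrite mxE.
Qed.

Lemma bmul_inj n m (b : 'I_n -> M) (P Q : 'M[A]_(n, m)) :
  is_basis b -> bmul b P =1 bmul b Q -> P = Q.
Proof.
move=> /is_basisP[inj _] PQ; apply/matrixP => i j.
have := PQ j; rewrite !bmulE => /inj /matrixP /(_ i 0).
by rewrite !mxE.
Qed.

Lemma basis_family n m (b : 'I_n -> M) (x : 'I_m -> M) :
  is_basis b -> exists P : 'M[A]_(n, m), x =1 bmul b P.
Proof.
move=> /is_basisP[_ surj]; have /choice[c hc] j : exists c, x j = comb b c by [].
exists (\matrix_(i, j) c j i 0) => j; rewrite hc.
by apply: eq_bigr => i _; rewrite mxE.
Qed.

Lemma bmul1 n (b : 'I_n -> M) : bmul b 1%:M =1 b.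
Proof.
move=> j; rewrite /bmul (bigD1 j) //= mxE eqxx scale1r big1 ?addr0 // => i ij.
by rewrite mxE (negbTE ij) scale0r.
Qed.

Lemma bmul_basis n (b : 'I_n -> M) (P Q : 'M[A]_n) :
  is_basis b -> P *m Q = 1%:M -> is_basis (bmul b P).
Proof.
move=> /is_basisP[inj surj] PQ; apply/is_basisP; split=> [c d|x].
  rewrite !comb_bmul => /inj /(congr1 (mulmx Q)).
  by rewrite !mulmxA (mulmx1C PQ) !mul1mx.
have [c ->] := surj x; exists (Q *m c).
by rewrite comb_bmul mulmxA PQ mul1mx.
Qed.

Lemma eq_bmul n m (b b' : 'I_n -> M) (P : 'M[A]_(n, m)) :
  b =1 b' -> bmul b P =1 bmul b' P.
Proof. by move=> e j; apply: eq_bigr => i _; rewrite e. Qed.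

End Combinations.

(** Mutually inverse matrices over a field are square; once the sizes are identified, [P] conjugates
    the characteristic matrices. *)
Lemma conjugate_char_poly (K : fieldType) n r (A : 'M[K]_n) (B : 'M[K]_r)
    (P : 'M[K]_(n, r)) (Q : 'M[K]_(r, n)) :
  P *m Q = 1%:M -> Q *m P = 1%:M -> A *m P = P *m B ->
  n = r /\ char_poly A = char_poly B.
Proof.
move=> PQ QP AP; have nr : n = r.
  by apply/eqP; rewrite eqn_leq (mulmx1_min PQ) (mulmx1_min QP).
split=> //; case: r / nr B P Q PQ QP AP => B P Q PQ QP AP.
pose Pc := map_mx polyC P; pose Qc := map_mx polyC Q.
have e : char_poly_mx A *m Pc = Pc *m char_poly_mx B.
  rewrite mulmxBl mulmxBr mul_scalar_mx mul_mx_scalar -!map_mxM.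
  by rewrite AP.
have d1 : \det Pc * \det Qc = 1 by rewrite -det_mulmx -map_mxM PQ map_mx1 det1.
rewrite /char_poly -[LHS]mulr1 -d1 mulrA -det_mulmx e det_mulmx mulrC mulrA.
by rewrite [\det Qc * _]mulrC d1 mul1r.
Qed.

(** * The fibre at [z = 0] and the exponents *)

Section Fibers.
Context (E : fieldType) (M : lmodType (fps E)).

(** A series differs from its constant coefficient by a multiple of [z]. *)
Lemma fiber_pi_scale (f : fps E) (x : M) :
  fiber_pi (f *: x) = fcoef f 0 *: fiber_pi x.
Proof.
rewrite -[RHS]/(fiber_scale _ _) fiber_scale_pi; apply/fiber_piP.
rewrite -scalerBl; apply/zMP.
exists (Fps (fun n => fcoef f n.+1) *: x); rewrite scalerA; congr (_ *: _).
apply: fpsP => -[|n]; rewrite fcoef_zM /=; first by rewrite subrr.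
by rewrite subr0.
Qed.

Lemma fiber_pi_comb n (b : 'I_n -> M) c :
  fiber_pi (comb b c) = comb (fun i => fiber_pi (b i)) (cmx 0 c).
Proof.
have pi0 : fiber_pi (0 : M) = 0 by rewrite -(scale0r 0) fiber_pi_scale scale0r.
rewrite /comb (big_morph (@fiber_pi E M) (@fiber_piD E M) pi0).
by apply: eq_bigr => i _; rewrite fiber_pi_scale mxE.
Qed.

Lemma fiber_basis n (b : 'I_n -> M) :
  is_basis b -> is_basis (fun i => fiber_pi (b i)).
Proof.
move=> /is_basisP[inj surj]; apply/is_basisP; split=> [c d|y].
  (* Scalars are lifted to constant series; a relation in the fibre then makes the difference of the
     lifts divisible by [z], hence zero in degree 0. *)
  have lift u : comb (fun i => fiber_pi (b i)) u =
      fiber_pi (comb b (map_mx fpsC u)).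
    by rewrite fiber_pi_comb; congr comb; apply/matrixP => i j; rewrite !mxE.
  rewrite !lift => /fiber_piP/zMP[z].
  have [w ->] := surj z.
  have -> : fpsz *: comb b w = comb b (fpsz *: w).
    by rewrite /comb scaler_sumr; apply: eq_bigr => i _; rewrite mxE scalerA.
  have -> : comb b (map_mx fpsC c) - comb b (map_mx fpsC d) =
      comb b (map_mx fpsC c - map_mx fpsC d).
    by rewrite /comb -sumrB; apply: eq_bigr => i _; rewrite !mxE scalerBl.
  move=> /inj /matrixP cd; apply/matrixP => i j.
  have := cd i j; rewrite !mxE => /(congr1 (fun f => fcoef f 0)).
  by rewrite fcoef_zM => /eqP; rewrite subr_eq0 => /eqP.
have [c e] := surj (fiber_repr y); exists (cmx 0 c).
by rewrite -fiber_pi_comb -e fiber_reprK.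
Qed.

(** The constant term of the connection matrix represents the fibre map in the reduced basis, so it
    is conjugate to the matrix that defines the exponents. The size [n] is also compared with [r],
    since bases of lattices come with their own size. *)
Lemma exponents_basis (Ebar : closedFieldType) (iota : {rmorphism E -> Ebar})
    (phi : M -> M) r (lam : 'I_r -> Ebar) n (b : 'I_n -> M) (A : 'M[fps E]_n) :
  is_MIC phi r -> is_exponents iota phi lam -> is_basis b ->
  (fun j => phi (b j)) =1 bmul b A ->
  exists e : n = r, map_poly iota (char_poly (cmx 0 A)) =
    \prod_i ('X - (lam (cast_ord e i))%:P).
Proof.
move=> mic [b' [B [hb' phib' hB]]] hb phib.
pose pb i := fiber_pi (b i); have hpb : is_basis pb := fiber_basis hb.
have [P hP] := basis_family b' hpb; have [Q hQ] := basis_family pb hb'.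
have PQ : P *m Q = 1%:M.
  apply: (bmul_inj hpb) => j; rewrite -bmulM -(eq_bmul _ hP) -hQ.
  by rewrite bmul1.
have QP : Q *m P = 1%:M.
  apply: (bmul_inj hb') => j; rewrite -bmulM -(eq_bmul _ hQ) -hP.
  by rewrite bmul1.
have phipb j : fiber_map phi (pb j) = bmul pb (cmx 0 A) j.
  rewrite (fiber_map_pi _ mic) phib bmulE fiber_pi_comb bmulE.
  by congr comb; apply/matrixP => i k; rewrite !mxE.
have fadd x y : fiber_map phi (x + y) = fiber_map phi x + fiber_map phi y.
  rewrite -(fiber_reprK x) -(fiber_reprK y) -fiber_piD !(fiber_map_pi _ mic).
  rewrite -fiber_piD; congr fiber_pi.
  by have := mic_linear mic 1 (fiber_repr x) (fiber_repr y); rewrite !scale1r.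
have fscale c x : fiber_map phi (c *: x) = c *: fiber_map phi x.
  have cE (y : M) : c *: fiber_pi y = fiber_pi (fpsC c *: y).
    by rewrite fiber_pi_scale.
  rewrite -(fiber_reprK x) cE !(fiber_map_pi _ mic) cE; congr fiber_pi.
  rewrite (mic_leibniz mic).
  have -> : fpsz * fps_deriv (fpsC c) = 0.
    by apply: fpsP => k; rewrite fcoef_zM; case: k => [|k] /=; rewrite ?mul0rn ?if_same.
  by rewrite scale0r add0r.
have fcomb (u : 'cV[E]_n) :
    fiber_map phi (comb pb u) = comb (fun i => fiber_map phi (pb i)) u.
  have f0 : fiber_map phi 0 = 0 by have := fscale 0 0; rewrite !scale0r.
  rewrite /comb (big_morph (fiber_map phi) fadd f0).
  by apply: eq_bigr => i _; rewrite fscale.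
have AP : cmx 0 A *m P = P *m B.
  apply: (bmul_inj hpb) => j.
  have -> : bmul pb (P *m B) j = fiber_map phi (b' j).
    by rewrite phib' -bmulM -(eq_bmul _ hP).
  rewrite hP (bmulE pb P) fcomb.
  have -> : (fun i => fiber_map phi (pb i)) = bmul pb (cmx 0 A) by exact: funext.
  by rewrite comb_bmul bmulE !colE mulmxA.
have [nr cp] := conjugate_char_poly PQ QP AP.
exists nr; rewrite cp hB.
case: r / nr lam {hB b' B hb' phib' P hP Q hQ PQ QP AP mic cp} => lam.
by apply: eq_bigr => i _; rewrite cast_ord_id.
Qed.

End Fibers.

(** * Lattices *)

(** The algebraic properties of convergent series behind the dictionary between lattices and bases;
    stability under [z d/dz] makes spans [phi]-stable. *)
Record theta_subring (E : fieldType) (O : set (fps E)) : Prop := {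
  subring0 : O 0;
  subring1 : O 1;
  subringD : forall f g, O f -> O g -> O (f + g);
  subringM : forall f g, O f -> O g -> O (f * g);
  subring_theta : forall f, O f -> O (fps_theta f) }.

(** * Lattices as spans of bases *)

Section ConnectionModules.
Context (E : fieldType) (M : lmodType (fps E)) (phi : M -> M) (r : nat).
Hypothesis mic : is_MIC phi r.

(** In coordinates [phi] is [z d/dz + A], by additivity and the Leibniz rule. *)
Lemma phi_comb n (b : 'I_n -> M) (A : 'M[fps E]_n) c :
  (fun j => phi (b j)) =1 bmul b A ->
  phi (comb b c) = comb b (thetamx c + A *m c).
Proof.
move=> phib.
have phiD x y : phi (x + y) = phi x + phi y.
  by have := mic_linear mic 1 x y; rewrite !scale1r.
have phi0 : phi 0 = 0.
  by apply: (addrI (phi 0)); rewrite -phiD !addr0.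
rewrite {1}/comb (big_morph phi phiD phi0).
transitivity (comb b (thetamx c) + comb (bmul b A) c).
  rewrite /comb -big_split; apply: eq_bigr => i _ /=.
  by rewrite (mic_leibniz mic) phib mxE.
by rewrite comb_bmul /comb -big_split; apply: eq_bigr => i _; rewrite [in RHS]mxE scalerDl.
Qed.

Lemma phi_bmul n m (b : 'I_n -> M) (A : 'M[fps E]_n) (P : 'M[fps E]_(n, m)) j :
  (fun j => phi (b j)) =1 bmul b A ->
  phi (bmul b P j) = bmul b (thetamx P + A *m P) j.
Proof.
move=> phib; rewrite !bmulE (phi_comb _ phib); congr comb.
rewrite !colE mulmxDl -mulmxA -!colE; congr (_ + _).
by apply/matrixP => i k; rewrite !mxE.
Qed.

Variable O : set (fps E).
Hypothesis hO : theta_subring O.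

Let subring_sum (I : Type) (s : seq I) (P : pred I) (F : I -> fps E) :
  (forall i, P i -> O (F i)) -> O (\sum_(i <- s | P i) F i).
Proof. by move=> h; elim/big_ind: _ => //; [exact: subring0|exact: subringD]. Qed.

Definition span_set n (b : 'I_n -> M) : set M :=
  [set x | exists2 c : 'cV_n, (forall i, O (c i 0)) & x = comb b c].

Section Spans.
Context (n : nat) (b : 'I_n -> M).
Hypothesis hb : is_basis b.
Local Notation N := (span_set b).

Let N0 : N 0.
Proof.
exists 0 => [i|]; first by rewrite mxE; exact: subring0.
by rewrite /comb big1 // => i _; rewrite mxE scale0r.
Qed.

Let ND x y : N x -> N y -> N (x + y).
Proof.
move=> [c hc ->] [d hd ->]; exists (c + d).
  by move=> i; rewrite mxE; exact: subringD.
by rewrite /comb -big_split; apply: eq_bigr => i _; rewrite mxE scalerDl.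
Qed.

Let NZ f x : O f -> N x -> N (f *: x).
Proof.
move=> Of [c hc ->]; exists (f *: c).
  by move=> i; rewrite mxE; exact: subringM.
by rewrite /comb scaler_sumr; apply: eq_bigr => i _; rewrite mxE scalerA.
Qed.

Let Nb i : N (b i).
Proof.
exists (delta_mx i 0) => [j|].
  by rewrite mxE; case: eqP => _; [exact: subring1|exact: subring0].
by rewrite -[LHS]bmul1 bmulE col1.
Qed.

(** The scalar 0 lies in [O], so it can be moved across the tensor sign onto [x]. *)
Let tensor_zero x : N x -> tensor_eq O N [:: (x, 0)] [::].
Proof.
move=> Nx; apply: (tens_trans _ (tens_zero O N 0)); apply: tens_sym.
by have := tens_scale 0 (subring0 hO) Nx; rewrite scale0r mul0r.
Qed.

Let tensor_sum (s : seq 'I_n) (c : 'I_n -> fps E) f : (forall i, O (c i)) ->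
  tensor_eq O N [:: (\sum_(i <- s) c i *: b i, f)] [seq (b i, c i * f) | i <- s].
Proof.
move=> hc; elim: s => [|i s IH]; first by rewrite big_nil; exact: tens_zero.
have Ns : N (\sum_(j <- s) c j *: b j).
  by elim/big_ind: _ => // j _; exact: NZ.
rewrite big_cons; apply: tens_trans (tens_addl O f (NZ (hc i) (Nb i)) Ns) _.
rewrite /= -cat1s -[_ :: map _ _]cat1s; apply: tens_cat => //.
exact: tens_scale.
Qed.

Let tensor_add (s : seq 'I_n) (F G : 'I_n -> fps E) :
  tensor_eq O N ([seq (b i, F i) | i <- s] ++ [seq (b i, G i) | i <- s])
    [seq (b i, F i + G i) | i <- s].
Proof.
elim: s => [|i s IH]; first exact: tens_refl.
set S := map _ s in IH; set T := map _ s in IH.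
apply: (@tens_trans _ _ _ _ _ ([:: (b i, F i)] ++ ([:: (b i, G i)] ++ (S ++ T)))).
  rewrite -[X in tensor_eq _ _ X]/([:: (b i, F i)] ++ (S ++ ([:: (b i, G i)] ++ T))).
  apply: tens_cat; first exact: tens_refl.
  by rewrite !catA; apply: tens_cat; [exact: tens_comm|exact: tens_refl].
rewrite catA -[map _ (i :: s)]cat1s; apply: tens_cat => //.
by apply: tens_sym; exact: tens_addr.
Qed.

(** Every formal tensor reduces to one term per basis vector. Two tensors with equal value then have
    equal normal forms, as [b] is free over all series. *)
Let tensor_normal s : formal_tensor N s -> exists F : 'I_n -> fps E,
  tensor_eq O N s [seq (b i, F i) | i <- enum 'I_n] /\
  tensor_eval s = comb b (\col_i F i).
Proof.
elim: s => [_|[x f] s IH Ns].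
  exists (fun=> 0); split; last first.
    by rewrite /tensor_eval big_nil /comb big1 // => i _; rewrite mxE scale0r.
  elim: (enum 'I_n) => [|i l IHl]; first exact: tens_refl.
  apply: tens_sym; rewrite /= -cat1s -[[::]]cats0.
  by apply: tens_cat; [exact: tensor_zero|exact: tens_sym].
have [|F [hF eF]] := IH; first by move=> u us; apply: Ns; rewrite inE us orbT.
have [c hc xc] : N x by apply: (Ns (x, f)); rewrite mem_head.
exists (fun i => c i 0 * f + F i); split; last first.
  rewrite /tensor_eval big_cons -/(tensor_eval s) eF /= xc /comb scaler_sumr.
  rewrite -big_split; apply: eq_bigr => i _.
  by rewrite !mxE scalerDl scalerA mulrC.
rewrite -cat1s; apply: (tens_trans _ (tensor_add _ _ _)).
apply: tens_cat => //; rewrite xc.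
by have := tensor_sum (enum 'I_n) f (fun i => hc i); rewrite big_enum.
Qed.

Lemma span_lattice (A : 'M[fps E]_n) : (forall i j, O (A i j)) ->
  (fun j => phi (b j)) =1 bmul b A -> is_lattice O phi N.
Proof.
move=> OA phib; have /is_basisP[inj surj] := hb; split=> //.
- exists n, b; split=> // x [c hc ->].
  exists [ffun i => c i 0]; split.
    by split=> [i|]; rewrite ?ffunE //; apply: eq_bigr => i _; rewrite ffunE.
  move=> d [hd e]; apply/ffunP => i; rewrite ffunE.
  have -> : c = \col_i d i; last by rewrite mxE.
  by apply: inj; rewrite e; apply: eq_bigr => j _; rewrite mxE.
- move=> _ [c hc ->]; rewrite (phi_comb _ phib).
  exists (thetamx c + A *m c) => // i; rewrite !mxE; apply: (subringD hO).
    exact: (subring_theta hO).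
  by apply: subring_sum => j _; exact: (subringM hO).
- split=> [s t Ns Nt|x].
    have [F [sF ->]] := tensor_normal Ns; have [G [tG ->]] := tensor_normal Nt.
    move=> /inj /matrixP FG; have {}FG : F = G.
      by apply: funext => i; have := FG i 0; rewrite !mxE.
    by rewrite FG in sF; apply: tens_trans sF _; exact: tens_sym.
  have [c ->] := surj x; exists [seq (b i, c i 0) | i <- enum 'I_n]; split.
    by move=> _ /mapP[i _ ->]; exact: Nb.
  by rewrite /tensor_eval big_map big_enum.
Qed.

End Spans.

(* Coordinates on the lattice extend to functionals on formal tensors, so the
   injectivity of the base change map makes the basis free over all series. *)
Lemma lattice_span N : is_lattice O phi N ->
  exists n (b : 'I_n -> M), is_basis b /\ N = span_set b.
Proof.
move=> [N0 ND NZ [n [b [Nb free]]] _ [binj bsurj]].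
(* [co] is total and unconstrained outside [N], so that [ev] below is defined on arbitrary lists. *)
have /choice[co hco] x : exists c : 'I_n -> fps E, N x ->
    (forall i, O (c i)) /\ x = \sum_i c i *: b i.
  have [/free[c [hc _]]|?] := pselect (N x); last by exists (fun=> 0).
  by exists c.
have co_uniq x c : N x -> (forall i, O (c i)) -> x = \sum_i c i *: b i -> co x = c.
  move=> Nx Oc xc; have [d [_ ud]] := free _ Nx; have [Oco xco] := hco x Nx.
  have e1 : d = finfun (co x).
    apply: ud; split=> [i|]; rewrite ?ffunE //.
    by rewrite {1}xco; apply: eq_bigr => i _; rewrite ffunE.
  have e2 : d = finfun c.
    apply: ud; split=> [i|]; rewrite ?ffunE //.
    by rewrite {1}xc; apply: eq_bigr => i _; rewrite ffunE.
  by apply: funext => i; have /ffunP/(_ i) := etrans (esym e1) e2; rewrite !ffunE.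
pose ev i (s : seq (M * fps E)) := \sum_(u <- s) u.2 * co u.1 i.
have ev_cat i s t : ev i (s ++ t) = ev i s + ev i t by rewrite /ev big_cat.
have ev_eq s t : tensor_eq O N s t -> forall i, ev i s = ev i t.
  elim=> {s t} [//|s t _ IH i|s t u _ IH1 _ IH2 i|s s' t t' _ IH1 _ IH2 i|s t i
    |f i|x y f Nx Ny i|x f g Nx i|f x g Of Nx i].
  - by rewrite IH.
  - by rewrite IH1 IH2.
  - by rewrite !ev_cat IH1 IH2.
  - by rewrite !ev_cat addrC.
  - rewrite /ev big_seq1 big_nil /= (co_uniq 0 (fun=> 0)) ?mulr0 //.
      by move=> ?; exact: subring0.
    by rewrite big1 // => j _; rewrite scale0r.
  - have [[Ox ex] [Oy ey]] := (hco x Nx, hco y Ny).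
    rewrite /ev big_seq1 big_cons big_seq1 /= -mulrDr.
    rewrite (co_uniq (x + y) (fun i => co x i + co y i)) //; first exact: ND.
      by move=> j; exact: (subringD hO).
    rewrite {1}ex {1}ey -big_split; apply: eq_bigr => j _.
    by rewrite scalerDl.
  - by rewrite /ev big_seq1 big_cons big_seq1 /= mulrDl.
  - have [Ox ex] := hco x Nx; rewrite /ev !big_seq1 /=.
    rewrite (co_uniq (f *: x) (fun i => f * co x i)) ?mulrA ?(mulrC g) //.
    + exact: NZ.
    + by move=> j; exact: (subringM hO).
    + by rewrite {1}ex scaler_sumr; apply: eq_bigr => j _; rewrite scalerA.
have cob i j : co (b i) j = (i == j)%:R.
  rewrite (co_uniq (b i) (fun j => (i == j)%:R)) //.
    by move=> k; case: eqP => _; [exact: subring1|exact: subring0].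
  rewrite (bigD1 i) //= eqxx scale1r big1 ?addr0 // => k ki.
  by rewrite eq_sym (negbTE ki) scale0r.
have NE x (c : 'cV_n) : (forall i, O (c i 0)) -> x = comb b c -> N x.
  by move=> Oc ->; rewrite /comb; elim/big_ind: _ => // i _; exact: NZ.
exists n, b; split; last first.
  apply/seteqP; split=> [x Nx|x [c Oc xc]]; last exact: (NE x c).
  have [Ox ex] := hco x Nx; exists (\col_i co x i) => [i|].
    by rewrite mxE.
  by rewrite {1}ex; apply: eq_bigr => i _; rewrite mxE.
apply/is_basisP; split=> [c d cd|x].
  pose tl (c : 'cV[fps E]_n) := [seq (b i, c i 0) | i <- enum 'I_n].
  have tlN c' : formal_tensor N (tl c') by move=> _ /mapP[i _ ->]; exact: Nb.
  have tlE c' : tensor_eval (tl c') = comb b c'.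
    by rewrite /tensor_eval big_map big_enum.
  have tlev c' i : ev i (tl c') = c' i 0.
    rewrite /ev big_map big_enum (bigD1 i) //= cob eqxx mulr1 big1 ?addr0 //.
    by move=> j ji; rewrite cob (negbTE ji) mulr0.
  apply/matrixP => i j; rewrite (ord1 j) -!tlev; apply: ev_eq.
  by apply: binj; rewrite ?tlE.
have [s [Ns <-]] := bsurj x.
exists (\col_i ev i s); rewrite /tensor_eval /comb.
under [RHS]eq_bigr do rewrite mxE scaler_suml.
rewrite exchange_big /= big_seq [RHS]big_seq; apply: eq_bigr => u us.
have [_ {1}->] := hco u.1 (Ns u us).
by rewrite scaler_sumr; apply: eq_bigr => i _; rewrite scalerA.
Qed.

End ConnectionModules.

(** Convolution keeps geometric growth because the ultrametric inequality ignores the number of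
    terms, and [z d/dz] keeps it because integers have absolute value at most 1. *)
Lemma Odag_theta_subring (R : realType) (p : nat) (E : fieldType)
    (v : E -> \bar R) :
  prime p -> is_pabs p (nabs v p) -> theta_subring (Odag v p).
Proof.
move=> pp ha; pose OP f := OdagP f pp ha.
have ge0 (L : R) : 1 <= L -> 0 <= L by apply: le_trans.
split.
- by apply/OP; exists 1 => // n; rewrite /= if_same (pabs0 ha) exprn_ge0.
- apply/OP; exists 1 => // n; rewrite expr1n /=.
  by case: ifP => _; rewrite ?(pabs0 ha) ?(pabs1 ha).
- move=> f g /OP[L L1 hL] /OP[L' L1' hL']; apply/OP.
  exists (L * L') => [|n]; first by rewrite mulr_ege1.
  apply: (pabs_leD ha); [apply: le_trans (hL n) _|apply: le_trans (hL' n) _].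
    by rewrite lerXn2r ?nnegrE ?mulr_ge0 ?ge0 // ler_peMr ?ge0.
  by rewrite lerXn2r ?nnegrE ?mulr_ge0 ?ge0 // ler_peMl ?ge0.
- move=> f g /OP[L L1 hL] /OP[L' L1' hL']; apply/OP.
  exists (L * L') => [|n]; first by rewrite mulr_ege1.
  rewrite fcoefM; apply: (pabs_sum ha) => [|i _].
    by rewrite exprn_ge0 // mulr_ge0 ?ge0.
  rewrite (pabsM ha) exprMn ler_pM ?(pabs_ge0 ha) //.
    by rewrite (le_trans (hL i)) // ler_weXn2l.
  by rewrite (le_trans (hL' _)) // ler_weXn2l // ltnS leq_subr.
- move=> f /OP[L L1 hL]; apply/OP; exists L => // n.
  rewrite fcoef_theta (pabsM ha) (le_trans _ (hL n)) // ler_piMl ?(pabs_ge0 ha) //.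
  exact: (pabs_nat ha).
Qed.

Lemma Odag_poly (R : realType) (p : nat) (E : fieldType) (v : E -> \bar R)
    (f : fps E) n0 : prime p -> is_pabs p (nabs v p) ->
  (forall n, (n0 <= n)%N -> fcoef f n = 0) -> Odag v p f.
Proof.
move=> pp ha f0; apply/(OdagP f pp ha).
have [L L1 hL] := finite_ub (fun i : 'I_n0 => nabs v p (fcoef f i)).
have L0 := le_trans ler01 L1; exists L => // n.
have [le|lt] := leqP n0 n; first by rewrite f0 // (pabs0 ha) exprn_ge0.
by rewrite (le_trans (hL (Ordinal lt))) // ler_eXnr.
Qed.

(** * Existence, cohomology and uniqueness of lattices *)

Section RegularConnections.
Context (R : realType) (p : nat) (E : fieldType) (v : E -> \bar R).
Context (Ebar : closedFieldType) (iota : {rmorphism E -> Ebar}).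
Context (vbar : Ebar -> \bar R).
Context (M : lmodType (fps E)) (phi : M -> M) (r : nat) (lam : 'I_r -> Ebar).
Hypotheses (pp : prime p) (ha : is_pabs p (nabs v p)).
Hypothesis hb : is_pabs p (nabs vbar p).
Hypothesis hab : forall x, nabs vbar p (iota x) = nabs v p x.
Hypothesis natF0 : forall n, (0 < n)%N -> n%:R != 0 :> Ebar.
Hypotheses (mic : is_MIC phi r) (hlam : is_exponents iota phi lam).

Let hO := Odag_theta_subring pp ha.

Lemma Odag_geom_mx m s (P : 'M[fps E]_(m, s)) :
  (forall i j, Odag v p (P i j)) <-> geom_mx (nabs v p) P.
Proof.
split=> [OP|[L L1 hL] i j].
  by apply: geom_mx_entries => i j; exact/(OdagP _ pp ha).
by apply/(OdagP _ pp ha); exists L => // n; have := hL n i j; rewrite mxE.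
Qed.

(* With [B] the truncation of the connection matrix [A] below the degrees where
   [k + ad A_0] may be singular, the gauge equation for [P = 1 + Y] is linear in
   [Y] and solvable with [Y] of high order. *)
Lemma lattice_exists : exists N : set M, is_lattice (Odag v p) phi N.
Proof.
have [b basb] := mic_free mic.
have [A phib] := basis_family (fun j => phi (b j)) basb.
have [e hA] := exponents_basis mic hlam basb phib.
pose lam' i := lam (cast_ord e i).
have [n0 nz] := @eventually_nat_add_neq0 Ebar _
  (fun ij : 'I_r * 'I_r => lam' ij.1 - lam' ij.2) natF0.
(* Truncating at [n0.+1], not [n0], guarantees that [B] keeps the constant term of [A] and that [Y]
   has constant term 0. *)
pose B := mxseries (fun k => if (k < n0.+1)%N then cmx k A else 0).
have hB : map_poly iota (char_poly (cmx 0 B)) = \prod_i ('X - (lam' i)%:P).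
  by rewrite cmx_series.
have [|Y [Y0 hY]] := formal_solution ha hb hab (n0 := n0.+1) (B - A) hA hB.
  by move=> k kn i j; exact: (nz k (ltnW kn) (i, j)).
have eY : thetamx Y + A *m Y - Y *m B = B - A.
  (* Below degree [n0.+1] both sides vanish: [Y] has no term there and [B] agrees with [A]. *)
  apply: cmxP => k; have [lt|le] := ltnP k n0.+1; last exact: hY.
  rewrite cmx_connection cmxB (cmx_series k) lt subrr Y0 // scaler0 mulmx0 mul0mx.
  rewrite addr0 subr0 add0r big1 // => i _.
  by rewrite Y0 ?mulmx0 ?mul0mx ?subr0 // (ltn_trans _ lt).
pose P := 1%:M + Y.
have [Q PQ] : exists Q, P *m Q = 1%:M.
  by apply: mxseries_unit; rewrite cmxD cmx1 Y0 // addr0.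
have eP : thetamx P + A *m P = P *m B.
  have -> : thetamx P = thetamx Y.
    apply: cmxP => k; rewrite !cmx_theta cmxD cmx1 scalerDr.
    by case: k => [|k]; rewrite ?scale0r ?scaler0 ?add0r // raddf0 scaler0 add0r.
  rewrite /P mulmxDr mulmx1 mulmxDl mul1mx addrCA.
  by apply/eqP; rewrite -subr_eq -addrA eY addrC subrK.
exists (span_set (Odag v p) (bmul b P)).
apply: (span_lattice mic hO (bmul_basis basb PQ) (A := B)).
  move=> i j; apply: (Odag_poly (n0 := n0.+1) pp ha) => n le.
  by rewrite mxE /= ltnNge le /= mxE.
by move=> j; rewrite (phi_bmul mic _ _ phib) eP bmulM.
Qed.

(** Stability of [N] puts each [phi (b j)] in the convergent span of [b], and uniqueness of
    coordinates makes [A] convergent. *)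
Lemma lattice_matrix N : is_lattice (Odag v p) phi N ->
  exists n (b : 'I_n -> M) (A : 'M[fps E]_n) (e : n = r),
  [/\ is_basis b, N = span_set (Odag v p) b, (fun j => phi (b j)) =1 bmul b A,
    geom_mx (nabs v p) A & map_poly iota (char_poly (cmx 0 A)) =
      \prod_i ('X - (lam (cast_ord e i))%:P)].
Proof.
move=> latN; have [n [b [basb NE]]] := lattice_span hO latN.
have [A phib] := basis_family (fun j => phi (b j)) basb.
have [e hA] := exponents_basis mic hlam basb phib.
exists n, b, A, e; split=> //; apply/Odag_geom_mx => i j.
have : N (phi (b j)).
  apply: (lat_stable latN); rewrite NE; exists (delta_mx j 0) => [k|].
    by rewrite mxE; case: eqP => _; [exact: subring1 hO|exact: subring0 hO].
  by rewrite -[LHS]bmul1 bmulE col1.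
rewrite NE phib bmulE => -[c Oc].
by have /is_basisP[inj _] := basb => /inj /matrixP/(_ i 0); rewrite mxE => ->.
Qed.

(** The fact [pre], that [phi y] in [N] forces [y] in [N], gives surjectivity on kernels and
    injectivity on cokernels; surjectivity on cokernels needs only a formal solution in high
    degrees. *)
Lemma lattice_quasi_iso : (forall i, 0 < exptype vbar p (- lam i)%R)%E ->
  forall N : set M, is_lattice (Odag v p) phi N -> RGamma_quasi_iso phi N setT.
Proof.
move=> types N /lattice_matrix[n [b [A [e [basb NE phib gA hA]]]]].
have /is_basisP[inj surj] := basb.
(* Coordinate vectors are treated as matrices with one column, with a zero connection of rank one on
   the right, so the differences of eigenvalues are the exponents themselves. *)
pose V : 'M[fps E]_1 := 0.
have hV : map_poly iota (char_poly (cmx 0 V)) = \prod_(i < 1) ('X - (0 : Ebar)%:P).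
  rewrite cmx0 /char_poly det_mx11 !mxE !raddf0 addr0 mulr1n.
  by rewrite big_ord1 map_polyX addr0.
have pre y : N (phi y) -> N y.
  rewrite NE; have [c ->] := surj y; rewrite (phi_comb mic _ phib).
  move=> [d Od /inj cd]; exists c => // i.
  suff /Odag_geom_mx : geom_mx (nabs v p) c by [].
  apply: (geom_solution pp ha hb hab natF0 (V := V) hA hV) => //.
  - move=> k j; rewrite subr0; exact: (exptype_gt0_small_den hb).
  - by apply/Odag_geom_mx => k j; rewrite mxE; exact: (subring0 hO).
  - rewrite mulmx0 subr0 cd; apply/Odag_geom_mx => k j; rewrite (ord1 j).
    exact: Od.
have N0 : N 0.
  rewrite NE; exists 0 => [i|]; first by rewrite mxE; exact: (subring0 hO).
  by rewrite /comb big1 // => i _; rewrite mxE scale0r.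
split; split.
- by move=> x [].
- move=> x [_ x0]; exists x; last by rewrite /= subrr.
  by split=> //; apply: pre; rewrite x0.
- move=> x Nx [y _ yx]; exists y => //; apply: pre.
  by rewrite yx.
- move=> x _; have [f ->] := surj x.
  have [n0 nz] := @eventually_nat_add_neq0 Ebar _
    (fun i : 'I_n => lam (cast_ord e i) - 0) natF0.
  have [|Y [_ hY]] := formal_solution ha hb hab (n0 := n0) f hA hV.
    by move=> k kn i j; exact: (nz k kn i).
  (* What the formal solution leaves over has degree below [n0], hence lies in [N]. *)
  rewrite mulmx0 in hY; exists (comb b (f - (thetamx Y + A *m Y))).
    rewrite NE; exists (f - (thetamx Y + A *m Y)) => // i.
    apply: (Odag_poly (n0 := n0) pp ha) => k kn.
    have := hY k kn; rewrite subr0; move: (thetamx Y + A *m Y) => W.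
    move=> /matrixP/(_ i 0); rewrite [cmx k W i 0]mxE [cmx k f i 0]mxE => h.
    by rewrite mxE [(- W) i 0]mxE /= h subrr.
  exists (comb b Y) => //; rewrite (phi_comb mic _ phib).
  move: (thetamx Y + A *m Y) => W; rewrite /comb -sumrB; apply: eq_bigr => i _.
  by rewrite -scalerBl mxE [(- W) i 0]mxE opprB addrCA subrr addr0.
Qed.

(** The matrix [P] writing [b'] in terms of [b] satisfies a homogeneous linear equation with
    convergent coefficients, so it converges by [geom_solution]. *)
Lemma lattice_sub N N' : (forall i j, 0 < exptype vbar p (lam i - lam j)%R)%E ->
  is_lattice (Odag v p) phi N -> is_lattice (Odag v p) phi N' -> N' `<=` N.
Proof.
move=> types /lattice_matrix[n [b [A [e [basb -> phib gA hA]]]]].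
move=> /lattice_matrix[n' [b' [A' [e' [_ -> phib' gA' hA']]]]].
have [P hP] := basis_family b' basb.
have eP : thetamx P + A *m P - P *m A' = 0.
  apply/eqP; rewrite subr_eq0; apply/eqP; apply: (bmul_inj basb) => j.
  by rewrite -(phi_bmul mic _ _ phib) -hP phib' -bmulM; apply: eq_bmul.
have OP : forall i j, Odag v p (P i j).
  apply/Odag_geom_mx.
  apply: (geom_solution pp ha hb hab natF0 hA hA') => // [i j|].
    (* The denominators [k + lam i - lam j] are governed by the type of the opposite difference,
       which the hypothesis on all ordered pairs also covers. *)
    apply: (exptype_gt0_small_den hb); rewrite opprB; exact: types.
  rewrite eP; apply/Odag_geom_mx => i j; rewrite mxE; exact: (subring0 hO).
move=> _ [c Oc ->]; exists (P *m c).
  move=> i; rewrite mxE; elim/big_ind: _ => [|f g|j _].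
  - exact: (subring0 hO).
  - exact: (subringD hO).
  - exact: (subringM hO).
by rewrite -comb_bmul; apply: eq_bigr => i _; rewrite hP.
Qed.

End RegularConnections.

Theorem theorem11p2 (R : realType) (p : nat) (E : fieldType) (v : E -> \bar R)
    (Ebar : closedFieldType) (iota : {rmorphism E -> Ebar})
    (vbar : Ebar -> \bar R)
    (M : lmodType (fps E)) (phi : M -> M) (r : nat) (lam : 'I_r -> Ebar) :
  prime p ->
  [pchar E] =i pred0 ->
  is_valuation v ->
  (0 < v p%:R)%E ->
  is_alg_closure iota ->
  is_valuation vbar ->
  (forall x, vbar (iota x) = v x) ->
  is_MIC phi r ->
  is_exponents iota phi lam ->
  [/\ exists N : set M, is_lattice (Odag v p) phi N,
      (forall i, 0 < exptype vbar p (- lam i)%R)%E ->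
        forall N : set M, is_lattice (Odag v p) phi N ->
          RGamma_quasi_iso phi N setT
    & (forall i j, 0 < exptype vbar p (lam i - lam j)%R)%E ->
        exists! N : set M, is_lattice (Odag v p) phi N].
Proof.
move=> pp charE hv vp _ hvbar hvv mic hlam.
have natE0 n : (0 < n)%N -> n%:R != 0 :> E.
  by rewrite lt0n => n0; have /pcharf0P -> := charE.
have natF0 n : (0 < n)%N -> n%:R != 0 :> Ebar.
  by move=> n0; rewrite -(rmorph_nat iota) fmorph_eq0 natE0.
have vbp : vbar p%:R = v p%:R by rewrite -hvv rmorph_nat.
have ha : is_pabs p (nabs v p).
  by apply: nabs_is_pabs => //; exact/natE0/prime_gt0.
have hb : is_pabs p (nabs vbar p).
  by apply: nabs_is_pabs; rewrite ?vbp //; exact/natF0/prime_gt0.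
have hab x : nabs vbar p (iota x) = nabs v p x.
  by rewrite /nabs fmorph_eq0 hvv vbp.
have [N latN] := lattice_exists pp ha hb hab natF0 mic hlam.
split; first by exists N.
- exact: (lattice_quasi_iso pp ha hb hab natF0 mic hlam).
- move=> types; exists N; split=> // N' latN'.
  apply/seteqP; split;
    exact: (lattice_sub pp ha hb hab natF0 mic hlam types).
Qed.
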